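(* Let $M$ be the rank-$3$ matroid on the point set $[d]$ of one of the following finite planes, whose dependent hyperplanes (lines) are the lines of the plane (so a $3$-subset is dependent iff it lies on a line, and every $4$-subset is dependent): the projective planes $\mathrm{PG}(2,2)$ ($d=7$) or $\mathrm{PG}(2,3)$ ($d=13$), or the affine planes $\mathrm{AG}(2,3)$ ($d=9$) or $\mathrm{AG}(2,4)$ ($d=16$). Let $B$ be its set of lines. Then the set of maximal elements, in the weak order, of $\{N : N<M\}$ (matroids on $[d]$) consists exactly of: - for each $b\in B$, the rank-$3$ matroid $M_b$ on $[d]$ whose circuits of size at most $3$ are exactly the $3$-subsets of $b$ and the $2$-subsets of $[d]\setminus b$; - for each $i\in[d]$, the matroid $M_i$ on $[d]$ which is the direct sum of the rank-one matroid on $\{i\}$ (so $i$ is a coloop) and the rank-$2$ loopless matroid on $[d]\setminus\{i\}$ whose parallel classes are the sets $b\setminus\{i\}$ for $b\in B$ with $i\in b$; - for each $i\in[d]$, the matroid $M(i)$ whose circuits are the circuits of the deletion $M\setminus i$ together with $\{i\}$; - the uniform matroid $U_{2,d}$ of rank $2$ on $[d]$.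
   Context: The weak order on matroids on a common ground set: $N\le M$ iff every dependent set of $M$ is dependent in $N$; $N<M$ means $N\le M$ and $N\ne M$. *)

(* Defs.v *)
From HB Require Import structures.
From mathcomp Require Import all_boot all_algebra.

Set Implicit Arguments.
Unset Strict Implicit.
Unset Printing Implicit Defensive.

Import GRing.Theory.

Section Matroids.
Variable T : finType.
Implicit Types (A C E H : {set T}) (e x y : T).

Definition matroid_axioms E (I : {set {set T}}) : bool :=
  [&& [forall A in I, A \subset E],
      set0 \in I,
      [forall A in I, forall C : {set T}, (C \subset A) ==> (C \in I)]
    & [forall A in I, forall C in I,
         (#|A| < #|C|) ==> [exists x in C :\: A, x |: A \in I]]].

(* The ground set is a field, so that deletions and the summands of a direct
   sum live over the same carrier type; "a matroid on [d]" is a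
   [matroid 'I_d] whose ground set is [setT].  As [matroid_axioms] is boolean,
   two matroids are equal as soon as their ground sets and independent sets
   are. *)
Record matroid := Matroid {
  ground : {set T};
  indep : {set {set T}};
  _ : matroid_axioms ground indep }.

Implicit Types M N : matroid.

Definition dependent M A : bool := (A \subset ground M) && (A \notin indep M).

Definition circuit M C : bool :=
  dependent M C && [forall A : {set T}, (A \proper C) ==> (A \in indep M)].

Definition rk M A : nat := \max_(C in indep M | C \subset A) #|C|.

Definition rank M : nat := rk M (ground M).

Definition flat M A : bool :=
  (A \subset ground M) && [forall e in ground M :\: A, rk M A < rk M (e |: A)].

Definition hyperplane M H : bool := flat M H && ((rk M H).+1 == rank M).

Definition dependent_hyperplanes M : {set {set T}} :=
  [set H | hyperplane M H && dependent M H].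

Definition loop M e : bool := dependent M [set e].

Definition loopless M : bool := [forall e, ~~ loop M e].

Definition parallel_class M x : {set T} :=
  [set y in ground M | ~~ loop M y && ((y == x) || dependent M [set x; y])].

Definition parallel_classes M : {set {set T}} :=
  [set parallel_class M x | x in [set x in ground M | ~~ loop M x]].

Definition weak_le N M : Prop :=
  ground N = ground M /\ (forall A, dependent M A -> dependent N A).

Definition weak_lt N M : Prop := weak_le N M /\ N <> M.

Definition maximal_below M N : Prop :=
  weak_lt N M /\ (forall N', weak_lt N' M -> weak_le N N' -> N' = N).

Fact deletion_subproof M e :
  matroid_axioms (ground M :\ e) [set A in indep M | e \notin A].
Proof.
case: M => E I /= /and4P[/forall_inP sIE I0 /forall_inP hI /forall_inP aI].
apply/and4P; split.
- by apply/forall_inP=> A; rewrite inE subsetD1 => /andP[/sIE-> ->].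
- by rewrite !inE I0.
- apply/forall_inP=> A; rewrite inE => /andP[IA eA].
  apply/forallP=> C; apply/implyP=> sCA; rewrite inE.
  have /forallP/(_ C)/implyP-> //= := hI A IA.
  by apply: contra eA; apply: (subsetP sCA).
- apply/forall_inP=> A; rewrite inE => /andP[IA eA].
  apply/forall_inP=> C; rewrite inE => /andP[IC eC]; apply/implyP=> ltAC.
  have /forall_inP/(_ C IC)/implyP/(_ ltAC)/exists_inP[x xCA IxA] := aI A IA.
  apply/exists_inP; exists x => //; rewrite inE IxA !inE negb_or eA andbT.
  by apply: contraNneq eC => ->; move: xCA; rewrite inE => /andP[].
Qed.

Definition deletion M e : matroid := Matroid (deletion_subproof M e).

Fact uniform_subproof k : matroid_axioms setT [set A : {set T} | #|A| <= k].
Proof.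
apply/and4P; split.
- by apply/forall_inP=> A _; apply: subsetT.
- by rewrite inE cards0.
- apply/forall_inP=> A; rewrite inE => leAk; apply/forallP=> C.
  by apply/implyP=> /subset_leq_card leCA; rewrite inE (leq_trans leCA).
- apply/forall_inP=> A _; apply/forall_inP=> C; rewrite inE => leCk.
  apply/implyP=> ltAC; apply/exists_inP.
  have /subsetPn[x Cx nAx] : ~~ (C \subset A).
    by apply: contraL ltAC => /subset_leq_card; rewrite -leqNgt.
  by exists x; rewrite !inE ?Cx ?nAx // cardsU1 nAx (leq_trans _ leCk).
Qed.

Definition uniform k : matroid := Matroid (uniform_subproof k).

Definition is_direct_sum N N1 N2 : Prop :=
  [/\ [disjoint ground N1 & ground N2],
      ground N = ground N1 :|: ground N2
    & indep N = [set A1 :|: A2 | A1 in indep N1, A2 in indep N2]].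

Definition is_plane_matroid (B : {set {set T}}) M : Prop :=
  [/\ ground M = setT, rank M = 3 & dependent_hyperplanes M = B].

(* [N] is M_b. *)
Definition is_line_degeneration (b : {set T}) N : Prop :=
  [/\ ground N = setT, rank N = 3 &
      forall C, #|C| <= 3 ->
        circuit N C = ((#|C| == 3) && (C \subset b))
                      || ((#|C| == 2) && (C \subset ~: b))].

(* [N] is M_i. *)
Definition is_coloop_degeneration (B : {set {set T}}) (i : T) N : Prop :=
  exists N1 N2 : matroid,
    [/\ ground N1 = [set i] /\ rank N1 = 1,
        ground N2 = ~: [set i] /\ rank N2 = 2,
        loopless N2,
        parallel_classes N2 = [set b :\ i | b in [set b in B | i \in b]]
      & is_direct_sum N N1 N2].

(* [N] is M(i). *)
Definition is_loop_degeneration M (i : T) N : Prop :=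
  ground N = setT /\
  (forall C, circuit N C <-> circuit (deletion M i) C \/ C = [set i]).

End Matroids.

Arguments uniform : clear implicits.

(* [B] is the set of lines of PG(2, q) (resp. AG(2, q)) after some labelling
   [phi] of the points of the plane by 'I_d. *)
Definition is_PG2 (q d : nat) (B : {set {set 'I_d}}) : Prop :=
  exists (F : finFieldType) (phi : 'I_d -> {vspace 'rV[F]_3}),
    [/\ #|F| = q,
        injective phi,
        forall U : {vspace 'rV[F]_3}, \dim U = 1 <-> exists i, phi i = U
      & forall b : {set 'I_d}, b \in B <->
          exists W : {vspace 'rV[F]_3},
            \dim W = 2 /\ b = [set i | (phi i <= W)%VS]].

Definition is_AG2 (q d : nat) (B : {set {set 'I_d}}) : Prop :=
  exists (F : finFieldType) (phi : 'I_d -> 'rV[F]_2),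
    [/\ #|F| = q,
        bijective phi
      & forall b : {set 'I_d}, b \in B <->
          exists (x : 'rV[F]_2) (U : {vspace 'rV[F]_2}),
            \dim U = 1 /\ b = [set i | (phi i - x)%R \in U]].

(* Main.v *)
(** The plane matroids enter only through two properties of collinearity: the
    weak incidence axioms [plane_space] shared by the projective and the affine
    planes, and the rigidity [rainbow_rigid] of three-colourings without a
    rainbow line.

    Let N < M have rank 3 and no loop; otherwise N <= U_{2,d} or N <= M(i).  If
    N is simple, an N-line containing a triangle of M is closed under the lines
    of M, hence is everything.  So N has a parallel pair.  Let P be its parallel
    class and L an N-line through P.  The colouring with classes P, L \ P and
    the complement of L has no rainbow line, since a line of M that meets P and
    L \ P lies in L.  Rigidity, applied to all the N-lines through P, forces
    either the complement of some line b to be a parallel class (N <= M_b) or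
    the complement of some point i to be an N-line (N <= M_i).

    Rigidity is an exhaustive search: the three colours occur on a triangle,
    which may be taken as the basis of homogeneous (projective case) or
    barycentric (affine case) coordinates. *)

Require Import Defs.
From mathcomp Require Import all_boot all_algebra all_field.

Set Implicit Arguments.
Unset Strict Implicit.
Unset Printing Implicit Defensive.

(** * Matroids through their independent sets *)

Section MatroidBasics.
Variable T : finType.
Implicit Types (M N : matroid T) (A C : {set T}).

(** For a single N-line L through P, with z in L \ P, rigidity leaves two outcomes that decide
    nothing: L may lie inside a line of M, or z may be the only point of L \ P and every line of M
    through z lies, apart from z, entirely inside or entirely outside P. Varying z over the
    complement of P removes them. If some L lies inside a line of M then so does P, and a point off
    that line admits neither outcome. If every z is of the second kind, the complement of P is
    closed under the lines of M and misses p, so it lies in one line, off which all points are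
    parallel.

    The axioms serve planes with and without parallel lines, so a construction that intersects lines
    keeps two candidate lines through a point and uses whichever meets the given one. One vector
    model serves both kinds of plane: a projective point is represented by a spanning vector, an
    affine point is lifted to height 1, and collinearity is linear dependence in both. As any
    triangle can be the basis, one numerical table per plane replaces the geometry. *)

Lemma matroid_eq M N : ground M = ground N -> indep M = indep N -> M = N.
Proof.
case: M N => [E I p] [E' I' p'] /= eE eI; rewrite -{}eE -{}eI in p' *.
by rewrite (bool_irrelevance p p').
Qed.

Lemma indep_ground M A : A \in indep M -> A \subset ground M.
Proof. by case: M => E I /= /and4P[/forall_inP h _ _ _]; apply: h. Qed.

Lemma indep0 M : set0 \in indep M.
Proof. by case: M => E I /= /and4P[]. Qed.

Lemma indepS M A C : C \subset A -> A \in indep M -> C \in indep M.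
Proof.
case: M => E I /= /and4P[_ _ /forall_inP h _] sCA /h/forallP/(_ C)/implyP.
by apply.
Qed.

Lemma indep_augment M A C :
    A \in indep M -> C \in indep M -> #|A| < #|C| ->
  exists x, [/\ x \in C, x \notin A & x |: A \in indep M].
Proof.
case: M => E I /= /and4P[_ _ _ /forall_inP h] /h/forall_inP hA /hA/implyP hC.
by move=> /hC/exists_inP[x /setDP[Cx nAx] Ix]; exists x.
Qed.

Lemma indep_extend M A C :
    A \in indep M -> C \in indep M -> #|A| <= #|C| ->
  exists D, [/\ D \in indep M, A \subset D, D \subset A :|: C & #|D| = #|C|].
Proof.
move=> IA IC; elim: {A}_.+1 {-2}A (ltnSn (#|C| - #|A|)) IA => // n IHn A.
rewrite ltnS => len IA; rewrite leq_eqVlt => /predU1P[eAC|ltAC].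
  by exists A; rewrite subsetUl.
have [x [Cx nAx IxA]] := indep_augment IA IC ltAC.
have cx : #|x |: A| = #|A|.+1 by rewrite cardsU1 nAx.
have lt_n : #|C| - #|x |: A| < n.
  by rewrite cx (leq_trans _ len) // subnS prednK // subn_gt0.
have [|D [ID sD sD' cD]] := IHn _ lt_n IxA; first by rewrite cx.
exists D; split=> //; first exact: subset_trans (subsetUr _ _) sD.
apply: subset_trans sD' _; rewrite !subUset sub1set subsetUl subsetUr !inE Cx.
by rewrite orbT.
Qed.

Lemma leq_rk M A C : C \in indep M -> C \subset A -> #|C| <= rk M A.
Proof.
move=> IC sCA; rewrite /rk.
by apply: (@leq_bigmax_cond _ _ (fun D : {set T} => #|D|)); rewrite IC.
Qed.

Lemma rk_leqP M A k :
  reflect (forall C, C \in indep M -> C \subset A -> #|C| <= k) (rk M A <= k).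
Proof.
apply: (iffP idP) => [le_k C IC sCA|h].
  exact: leq_trans (leq_rk IC sCA) le_k.
by apply/bigmax_leqP => C /andP[IC sCA]; apply: h.
Qed.

Lemma rk_basis M A : exists C, [/\ C \in indep M, C \subset A & #|C| = rk M A].
Proof.
pose P := [pred C : {set T} | (C \in indep M) && (C \subset A)].
have P0 : 0 < #|P|.
  by apply/card_gt0P; exists set0; rewrite inE indep0 sub0set.
have [C /andP[IC sCA] eC] := eq_bigmax_cond (fun C : {set T} => #|C|) P0.
by exists C; split=> //; rewrite -eC; apply: eq_bigl.
Qed.

Lemma dependent_circuit M A :
  dependent M A -> exists2 C : {set T}, C \subset A & circuit M C.
Proof.
move=> dA; have [C /minsetP[dC minC] sCA] := minset_exists (P := dependent M) dA.
exists C => //; rewrite /circuit dC; apply/forallP=> D; apply/implyP=> prDC.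
have sDC := proper_sub prDC.
apply: contraTT prDC => nID; rewrite (minC D) ?properxx // /dependent nID andbT.
by rewrite (subset_trans sDC) //; case/andP: dC.
Qed.

Lemma indep_circuitsP M A : A \subset ground M ->
  reflect (forall C, C \subset A -> ~~ circuit M C) (A \in indep M).
Proof.
move=> sAE; apply: (iffP idP) => [IA C sCA|h].
  by rewrite /circuit /dependent (indepS sCA IA) andbF.
apply: contraT => nIA; have [|C sCA cC] := @dependent_circuit M A.
  by rewrite /dependent sAE.
by have := h C sCA; rewrite cC.
Qed.

(** Over the full ground set a set is dependent exactly when it is not independent, so the weak
    order turns into inclusion of independent sets, the form used from here on. *)
Lemma weak_leP M N : ground M = setT -> ground N = setT ->
  weak_le N M <-> indep N \subset indep M.
Proof.
move=> gM gN; split=> [[_ h]|/subsetP h].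
  apply/subsetP=> A IA; apply: contraLR IA => nIA.
  by have /andP[] : dependent N A by apply: h; rewrite /dependent gM subsetT.
split; rewrite ?gM // => A; rewrite /dependent gM gN !subsetT /=.
by apply: contra; apply: h.
Qed.

End MatroidBasics.

(** * Independent pairs and triples, and the lines they span *)

Section SmallIndep.
Variables (T : finType) (N : matroid T).
Implicit Types (x y z a b c : T) (A C : {set T}).

(** The disequality excludes the degenerate case where [[set x; y]] is a singleton. In a loopless
    matroid [~~ indep2 x y] thus means equal or parallel; likewise, for an independent pair x, y,
    the points w with [~~ indep3 x y w] form the line spanned by x and y. *)
Definition indep2 x y := (x != y) && ([set x; y] \in indep N).

Definition indep3 x y z :=
  [&& x != y, x != z, y != z & [set x; y; z] \in indep N].

Lemma indep2C x y : indep2 x y = indep2 y x.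
Proof. by rewrite /indep2 eq_sym setUC. Qed.

Lemma indep3C12 x y z : indep3 x y z = indep3 y x z.
Proof.
by rewrite /indep3 (eq_sym y x) (setUC [set y]); case: eqP => //= _; rewrite andbCA.
Qed.

Lemma indep3C23 x y z : indep3 x y z = indep3 x z y.
Proof. by rewrite /indep3 (eq_sym z y) setUAC andbCA. Qed.

Lemma indep3_indep2 x y z : indep3 x y z -> indep2 x y.
Proof.
case/and4P=> nxy _ _ I; rewrite /indep2 nxy; apply: indepS I; exact: subsetUl.
Qed.

Lemma indep3_sub A x y z :
    A \in indep N -> x \in A -> y \in A -> z \in A ->
  x != y -> x != z -> y != z -> indep3 x y z.
Proof.
move=> IA Ax Ay Az xy xz yz; rewrite /indep3 xy xz yz; apply: indepS IA.
by rewrite !subUset !sub1set Ax Ay Az.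
Qed.

Lemma indep2_sub A x y :
  A \in indep N -> x \in A -> y \in A -> x != y -> indep2 x y.
Proof.
move=> IA Ax Ay xy; rewrite /indep2 xy; apply: indepS IA.
by rewrite !subUset !sub1set Ax Ay.
Qed.

(** Augmenting {x, y} from a larger C would give a point of C outside the line spanned by x and
    y. *)
Lemma closure2_rank x y C :
    indep2 x y -> C \in indep N -> {in C, forall w, ~~ indep3 x y w} ->
  #|C| <= 2.
Proof.
case/andP=> nxy Ixy IC hC; rewrite leqNgt; apply/negP => ltC.
have [|w [Cw]] := indep_augment Ixy IC; first by rewrite cards2 nxy.
rewrite !inE negb_or => /andP[wx wy] I3; have /negP[] := hC w Cw.
by rewrite /indep3 nxy (eq_sym x) (eq_sym y) wx wy setUC.
Qed.

Lemma indep3_exchange_imp x y a b c :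
    indep2 x y -> ~~ indep3 x y a -> ~~ indep3 x y b ->
  indep3 a b c -> indep3 x y c.
Proof.
move=> Ixy na nb /and4P[ab ac bc I]; apply: contraT => nc.
have := closure2_rank Ixy I; rewrite setUC cardsU1 cards2 !inE.
rewrite (eq_sym c a) (eq_sym c b) (negbTE ac) (negbTE bc) ab; apply.
by move=> w; rewrite !inE => /or3P[] /eqP->.
Qed.

Lemma indep3xyx x y : ~~ indep3 x y x.
Proof. by rewrite /indep3 eqxx /= andbF. Qed.

Lemma indep3xyy x y : ~~ indep3 x y y.
Proof. by rewrite /indep3 eqxx /= !andbF. Qed.

(** The line through x and y has rank 2, so any independent pair a, b on it spans it. A line of the
    matroid can therefore be named by whichever pair is at hand. *)
Lemma indep3_exchange x y a b c :
    indep2 x y -> indep2 a b -> ~~ indep3 x y a -> ~~ indep3 x y b ->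
  indep3 a b c = indep3 x y c.
Proof.
move=> Ixy Iab na nb; apply/idP/idP; first exact: indep3_exchange_imp.
apply: indep3_exchange_imp Iab _ _.
  by apply/negP=> /(indep3_exchange_imp Ixy na nb); apply/negP/indep3xyx.
by apply/negP=> /(indep3_exchange_imp Ixy na nb); apply/negP/indep3xyy.
Qed.

Lemma dep2_trans x y z : [set y] \in indep N ->
  ~~ indep2 x y -> ~~ indep2 y z -> ~~ indep2 x z.
Proof.
move=> Iy nxy nyz; apply/negP => /andP[xz Ixz].
have [|w [+ + I]] := indep_augment Iy Ixz; first by rewrite cards1 cards2 xz.
rewrite !inE => /orP[] /eqP ew nwy; subst w.
  by move: nxy; rewrite /indep2 nwy I.
by move: nyz; rewrite indep2C /indep2 nwy I.
Qed.

Lemma card3P A : #|A| = 3 ->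
  exists x y z, [/\ x != y, x != z, y != z & A = [set x; y; z]].
Proof.
move=> cA; have /card_gt0P[x Ax] : 0 < #|A| by rewrite cA.
have c2 : #|A :\ x| == 2 by move: cA; rewrite (cardsD1 x) Ax add1n => -[->].
have /cards2P[y [z [yz e]]] := c2.
have: y \in A :\ x by rewrite e !inE eqxx.
have: z \in A :\ x by rewrite e !inE eqxx orbT.
rewrite !inE => /andP[zx _] /andP[yx _]; exists x, y, z.
by rewrite eq_sym yx eq_sym zx yz -(setD1K Ax) e setUA.
Qed.

End SmallIndep.

Arguments card3P {T A}.

(** * Planes *)

Record plane_space (T : finType) (coll : T -> T -> T -> bool) : Prop :=
  PlaneSpace {
    two_points : exists x y : T, x != y;
    collxxz : forall x z, coll x x z;
    collC12 : forall x y z, coll x y z = coll y x z;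
    collC23 : forall x y z, coll x y z = coll x z y;
    coll_exchange : forall x y z w,
      x != y -> coll x y z -> coll x y w -> coll x z w;
    coll_third : forall x y,
      x != y -> exists z, [/\ z != x, z != y & coll x y z];
    coll_off : forall x y, x != y -> exists z, ~~ coll x y z;
    (* At most one line through z is parallel to the line xy: this covers
       both the projective and the affine planes. *)
    coll_meet : forall x y z w w',
      ~~ coll x y z -> ~~ coll z w w' ->
      exists u, coll x y u && (coll z w u || coll z w' u) }.

Definition line (T : finType) (coll : T -> T -> T -> bool) (x y : T) : {set T} :=
  [set z | coll x y z].

(** The two alternatives are the evident ways to avoid a rainbow line. If all points off one line
    share a colour, any other line meets it at most once and so shows at most two colours. If i is
    alone in its colour, lines missing i lack that colour, and lines through i show a single further
    one. *)
Definition rainbow_rigid (T : finType) (coll : T -> T -> T -> bool) : Prop :=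
  forall c : T -> nat,
    (forall x, c x < 3) ->
    (exists x, c x = 0) -> (exists x, c x = 1) -> (exists x, c x = 2) ->
    (forall x y z, coll x y z -> c x = 0 -> c y = 1 -> c z = 2 -> False) ->
    (exists x y k, x != y /\ forall z, ~~ coll x y z -> c z = k) \/
    (exists i, (forall z, c z = c i -> z = i) /\
      forall z w, z != i -> w != i -> coll i z w -> c z = c w).

Section PlaneSpace.
Variables (T : finType) (coll : T -> T -> T -> bool).
Hypothesis hP : plane_space coll.

Lemma coll_rot x y z : coll x y z = coll y z x.
Proof. by rewrite (collC12 hP) (collC23 hP). Qed.

Lemma collC13 x y z : coll x y z = coll z y x.
Proof. by rewrite coll_rot (collC12 hP). Qed.

Lemma collxyx x y : coll x y x.
Proof. by rewrite (collC23 hP) (collxxz hP). Qed.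

Lemma collxyy x y : coll x y y.
Proof. by rewrite (collC12 hP) collxyx. Qed.

Lemma coll_line x y a b c :
  x != y -> a != b -> coll x y a -> coll x y b -> coll a b c = coll x y c.
Proof.
have imp x' y' a' b' c' : x' != y' -> coll x' y' a' -> coll x' y' b' ->
    coll x' y' c' -> coll a' b' c'.
  move=> xy ha hb hc; have [->|xa] := eqVneq a' x'.
    exact: (coll_exchange hP xy).
  have xab := coll_exchange hP xy ha hb.
  have xac := coll_exchange hP xy ha hc.
  by apply: (coll_exchange hP xa); rewrite (collC12 hP).
move=> xy ab ha hb; apply/idP/idP; last exact: (imp x y a b c).
apply: (imp a b x y c) => //; first by apply: (imp x y); rewrite ?collxyx.
by apply: (imp x y); rewrite ?collxyy.
Qed.

Lemma coll_neq x y z : ~~ coll x y z -> [/\ x != y, x != z & y != z].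
Proof.
move=> h; split; apply: contraNneq h => ->; first exact: (collxxz hP).
  exact: collxyx.
exact: collxyy.
Qed.

(** Let z' be a third point of the line zx, so that z and z' are two points of X off the line xy.
    For w outside X, at most one of the lines wz and wz' is parallel to xy. The other one meets xy
    in a point of X; it then has two points in X and must lie in X, w included. *)
Lemma subspace_full (X : {set T}) x y z :
    (forall a b c, a \in X -> b \in X -> a != b -> coll a b c -> c \in X) ->
    x \in X -> y \in X -> z \in X -> ~~ coll x y z ->
  X = setT.
Proof.
move=> clX Xx Xy Xz nxyz; have [xy xz yz] := coll_neq nxyz.
apply/setP=> w; rewrite inE; apply: contraT => nXw.
have zx : z != x by rewrite eq_sym.
have [z' [z'z z'x hz']] := coll_third hP zx.
have Xz' := clX _ _ _ Xz Xx zx hz'.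
have nxyw : ~~ coll x y w by apply: contra nXw => /clX; apply.
have nwzz' : ~~ coll w z z'.
  apply: contra nXw => h; apply: (clX z z') => //; first by rewrite eq_sym.
  by rewrite -coll_rot.
have nxyz' : ~~ coll x y z'.
  apply: contra nxyz => h; have xz' : x != z' by rewrite eq_sym.
  apply: (coll_exchange hP xz'); first by rewrite (collC23 hP).
  by rewrite -coll_rot.
have [u /andP[xyu]] := coll_meet hP nxyw nwzz'.
have Xu := clX _ _ _ Xx Xy xy xyu; move=> /orP[] h; apply: contraNT nXw => _.
  apply: (clX z u) => //; last by rewrite -coll_rot.
  by apply: contraNneq nxyz => ->.
apply: (clX z' u) => //; last by rewrite -coll_rot.
by apply: contraNneq nxyz' => ->.
Qed.



End PlaneSpace.

(** * The matroid of a plane *)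

Section PlaneMatroid.
Variables (T : finType) (coll : T -> T -> T -> bool).
Variables (B : {set {set T}}) (M : matroid T).
Hypothesis hP : plane_space coll.
Hypothesis hB : forall b, b \in B <-> exists x y, x != y /\ b = line coll x y.
Hypothesis hM : is_plane_matroid B M.
Implicit Types (x y z e f : T) (A C : {set T}).

Let groundM : ground M = setT. Proof. by case: hM. Qed.
Let rankM : rank M = 3. Proof. by case: hM. Qed.

Lemma line_hyperplane x y : x != y ->
  hyperplane M (line coll x y) && dependent M (line coll x y).
Proof.
move=> xy; have : line coll x y \in B by apply/hB; exists x, y.
by case: hM => _ _ <-; rewrite inE.
Qed.

Lemma hyperplane_line H : hyperplane M H -> dependent M H ->
  exists x y, x != y /\ H = line coll x y.
Proof. by move=> h d; apply/hB; case: hM => _ _ <-; rewrite inE h d. Qed.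

Lemma line_avoiding e : exists x y, x != y /\ ~~ coll x y e.
Proof.
have [y ye] : exists y, y != e.
  have [x [y xy]] := two_points hP; have [<-|] := eqVneq x e; last by exists x.
  by exists y; rewrite eq_sym.
have [z nz] := coll_off hP ye; have [_ yz _] := coll_neq hP nz.
by exists y, z; rewrite (collC23 hP).
Qed.

Lemma plane_card_indep A : A \in indep M -> #|A| <= 3.
Proof. by move=> IA; rewrite -rankM; apply: leq_rk (indep_ground IA). Qed.

(** [is_plane_matroid] prescribes only the rank and the dependent hyperplanes, so simplicity has to
    be derived. A flat contains every loop, but some line, which is a flat, misses e. *)
Lemma plane_indep1 e : [set e] \in indep M.
Proof.
apply: contraT => nIe; have [x [y [xy ne]]] := line_avoiding e.
have /andP[/andP[/andP[_ /forall_inP h] _] _] := line_hyperplane xy.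
have := h e; rewrite !inE ne groundM inE => /(_ isT).
rewrite ltnNge => /negP[]; apply/rk_leqP => C IC sC; apply: leq_rk => //.
apply/subsetP => w Cw; have := subsetP sC w Cw; rewrite !inE.
case/predU1P=> // we; case/negP: nIe; apply: indepS IC.
by rewrite sub1set -we.
Qed.

(** A flat containing e contains every point parallel to e, whereas the line through e and a point z
    off the line ef misses f. *)
Lemma plane_indep2 e f : e != f -> indep2 M e f.
Proof.
move=> ef; rewrite /indep2 ef; apply: contraT => nI.
have [z nz] := coll_off hP ef; have [_ ez _] := coll_neq hP nz.
have /andP[/andP[/andP[_ /forall_inP h] _] _] := line_hyperplane ez.
have := h f; rewrite !inE groundM inE (collC23 hP) nz => /(_ isT).
rewrite ltnNge => /negP[].
have [C [IC sC <-]] := rk_basis M (f |: line coll e z).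
have [->|C0] := eqVneq C set0; first by rewrite cards0.
have [|D [ID eD sD <-]] := indep_extend (plane_indep1 e) IC.
  by rewrite cards1 card_gt0.
rewrite sub1set in eD.
apply: leq_rk => //; apply/subsetP => w Dw; have := subsetP sD w Dw.
rewrite inE => /orP[/set1P->|/(subsetP sC)]; first by rewrite inE (collxyx hP).
rewrite in_setU1 => /predU1P[wf|//]; case/negP: nI; apply: indepS ID.
by rewrite subUset !sub1set eD -wf.
Qed.

Lemma plane_indep_small A : #|A| <= 2 -> A \in indep M.
Proof.
rewrite leq_eqVlt => /orP[/cards2P[x [y [xy ->]]]|].
  by have /andP[] := plane_indep2 xy.
rewrite ltnS leq_eqVlt => /orP[/cards1P[x ->]|]; first exact: plane_indep1.
by rewrite ltnS leqn0 cards_eq0 => /eqP->; apply: indep0.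
Qed.

(** A collinear triple lies in a hyperplane, whose rank is 2. Conversely, if {x, y, z} is dependent,
    the closure of {x, y} is a hyperplane that is dependent, as it contains z; it is therefore one
    of the prescribed lines. *)
Lemma plane_indep3 x y z : indep3 M x y z = ~~ coll x y z.
Proof.
apply/idP/idP => [I3|nc].
  apply/negP => c; have /andP[xy _] := indep3_indep2 I3.
  have /andP[/andP[_ rkl] _] := line_hyperplane xy.
  case/and4P: I3 => _ xz yz I.
  have: #|[set x; y; z]| <= rk M (line coll x y).
    apply: leq_rk => //; rewrite !subUset !sub1set !inE.
    by rewrite (collxyx hP) (collxyy hP).
  rewrite -ltnS (eqP rkl) rankM setUC cardsU1 cards2 xy !inE.
  by rewrite (eq_sym z x) (eq_sym z y) (negbTE xz) (negbTE yz).
have [xy xz yz] := coll_neq hP nc.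
apply: contraNT nc => nI; have I2 := plane_indep2 xy.
pose H := [set w | ~~ indep3 M x y w].
have rkH : rk M H = 2.
  apply/eqP; rewrite eqn_leq; apply/andP; split.
    apply/rk_leqP => C IC /subsetP sC; apply: (closure2_rank I2 IC) => w /sC.
    by rewrite inE.
  case/andP: I2 => _ I2; have := leq_rk I2; rewrite cards2 xy; apply.
  by rewrite subUset !sub1set !inE indep3xyx indep3xyy.
have [||a [b [ab eH]]] := @hyperplane_line H.
- rewrite /hyperplane /flat rkH rankM groundM subsetT eqxx andbT /=.
  apply/forall_inP => e; rewrite !inE andbT negbK => I3.
  case/and4P: (I3) => _ xe ye I.
  apply: (@leq_trans #|[set x; y; e]|).
    rewrite setUC cardsU1 cards2 !inE xy (eq_sym e x) (eq_sym e y).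
    by rewrite (negbTE xe) (negbTE ye).
  apply: leq_rk => //; rewrite !subUset !sub1set !inE indep3xyx indep3xyy.
  by rewrite eqxx !orbT.
- rewrite /dependent groundM subsetT /=.
  apply: contra (nI) => IH; apply: (indep3_sub IH); rewrite ?inE //.
  + exact: indep3xyx.
  + exact: indep3xyy.
have inH w : w \in H = coll a b w by rewrite eH inE.
by rewrite (@coll_line _ _ hP a b) // -inH inE ?indep3xyx ?indep3xyy.
Qed.

End PlaneMatroid.

(** * The degenerations *)

Section LineDegeneration.
Variable T : finType.
Implicit Types (A C b : {set T}) (N : matroid T).

(** The direct sum of the uniform matroids of rank 2 on b and of rank 1 on its complement. *)
Definition line_degeneration_indep b :=
  [set A : {set T} | (#|A :&: b| <= 2) && (#|A :\: b| <= 1)].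

Lemma line_degeneration_axioms b :
  matroid_axioms setT (line_degeneration_indep b).
Proof.
apply/and4P; split.
- by apply/forall_inP=> A _; apply: subsetT.
- by rewrite inE set0I set0D cards0.
- apply/forall_inP=> A; rewrite inE => /andP[hb hn]; apply/forallP=> C.
  apply/implyP=> sCA; rewrite inE.
  rewrite (leq_trans (subset_leq_card (setSI b sCA)) hb).
  by rewrite (leq_trans (subset_leq_card (setSD b sCA)) hn).
- apply/forall_inP=> A; rewrite inE => /andP[Ab An].
  apply/forall_inP=> C; rewrite inE => /andP[Cb Cn]; apply/implyP=> ltAC.
  apply/exists_inP; have [leb|ltb] := leqP #|C :&: b| #|A :&: b|; last first.
    have /subsetPn[x] : ~~ (C :&: b \subset A :&: b).
      by apply: contraL ltb => /subset_leq_card; rewrite -leqNgt.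
    rewrite !inE => /andP[Cx bx]; rewrite bx andbT => nAx.
    exists x; rewrite !inE ?nAx //.
    have ->: (x |: A) :&: b = x |: (A :&: b).
      by rewrite setIUl (setIidPl _) // sub1set.
    have ->: (x |: A) :\: b = A :\: b.
      by rewrite setDUl; have /eqP-> : [set x] :\: b == set0;
        rewrite ?set0U // setD_eq0 sub1set.
    by rewrite An andbT cardsU1 inE (negbTE nAx) (leq_trans ltb).
  have ltn : #|A :\: b| < #|C :\: b|.
    move: ltAC; rewrite -(cardsID b A) -(cardsID b C) => h.
    by rewrite -(ltn_add2l #|A :&: b|) (leq_trans h) // leq_add2r.
  have /subsetPn[x] : ~~ (C :\: b \subset A :\: b).
    by apply: contraL ltn => /subset_leq_card; rewrite -leqNgt.
  rewrite !inE => /andP[bx Cx]; rewrite bx /= => nAx.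
  exists x; rewrite !inE ?nAx //.
  have ->: (x |: A) :&: b = A :&: b.
    by rewrite setIUl; have /eqP-> : [set x] :&: b == set0;
      rewrite ?set0U // setI_eq0 disjoints1.
  have ->: (x |: A) :\: b = x |: (A :\: b).
    by rewrite setDUl; congr (_ :|: _); apply/setDidPl; rewrite disjoints1.
  by rewrite Ab cardsU1 inE (negbTE nAx) andbF (leq_trans ltn).
Qed.

Definition line_degeneration b := Matroid (line_degeneration_axioms b).

Lemma ex_subset_card A k : k <= #|A| -> exists2 C : {set T}, C \subset A & #|C| = k.
Proof.
elim: {A}_.+1 {-2}A (ltnSn #|A|) => // n IHn A; rewrite ltnS => len.
rewrite leq_eqVlt => /predU1P[->|ltk]; first by exists A.
have /card_gt0P[x Ax] : 0 < #|A| by apply: leq_trans ltk.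
have cA : #|A| = #|A :\ x|.+1 by rewrite (cardsD1 x A) Ax.
rewrite cA in len ltk; have [C sC cC] := IHn _ len ltk.
by exists C => //; apply: subset_trans sC (subD1set _ _).
Qed.

(** Circuits of size at most 3 determine N: a set with at most two points in b and one outside has
    at most three points, so all circuits it could contain are prescribed. The conditions on b give
    the direct sum its rank 3. *)
Lemma is_line_degenerationE b N : 2 <= #|b| -> b != setT ->
  is_line_degeneration b N <-> N = line_degeneration b.
Proof.
move=> b2 bT; split=> [[gN _ cN]|->].
  apply: matroid_eq => //=; apply/setP=> A; rewrite inE.
  apply/idP/idP => [IA|/andP[Ab An]].
    apply/andP; split; rewrite leqNgt; apply/negP=> /ex_subset_card[C sC cC].
      have IC : C \in indep N.
        by apply: indepS IA; apply: subset_trans sC (subsetIl _ _).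
      have := cN C; rewrite /circuit /dependent IC andbF cC => /(_ isT) /=.
      by rewrite (subset_trans sC (subsetIr _ _)).
    have IC : C \in indep N.
      by apply: indepS IA; apply: subset_trans sC (subsetDl _ _).
    have := cN C; rewrite /circuit /dependent IC andbF cC => /(_ isT) /=.
    by rewrite (subset_trans sC) // setDE subsetIr.
  have A3 : #|A| <= 3 by rewrite -(cardsID b A) (leq_add Ab An).
  apply/indep_circuitsP; first by rewrite gN subsetT.
  move=> C sC; rewrite cN ?(leq_trans (subset_leq_card sC)) //.
  rewrite negb_or !negb_and; apply/andP; split.
    rewrite orbC -implybE; apply/implyP=> sCb.
    have : C \subset A :&: b by rewrite subsetI sC.
    by move/subset_leq_card/leq_trans/(_ Ab); case: eqP => // ->.
  rewrite orbC -implybE; apply/implyP=> sCb.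
  have : C \subset A :\: b by rewrite subsetD sC disjoints_subset.
  by move/subset_leq_card/leq_trans/(_ An); case: eqP => // ->.
split=> //.
  apply/eqP; rewrite eqn_leq; apply/andP; split.
    apply/rk_leqP=> C; rewrite inE => /andP[Cb Cn] _.
    by rewrite -(cardsID b C) (leq_add Cb Cn).
  have [C sC cC] := ex_subset_card b2.
  have /subsetPn[x _ nx] : ~~ (setT \subset b) by rewrite subTset.
  have nCx : x \notin C by apply: contra nx; apply: (subsetP sC).
  have <- : #|x |: C| = 3 by rewrite cardsU1 nCx cC.
  apply: leq_rk; last exact: subsetT.
  rewrite inE; apply/andP; split.
    rewrite -cC subset_leq_card //; apply/subsetP=> w; rewrite !inE.
    by case/andP=> /predU1P[->|//]; rewrite (negbTE nx).
  rewrite -(cards1 x) subset_leq_card //; apply/subsetP=> w; rewrite !inE.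
  by case/andP=> nw /predU1P[->//|/(subsetP sC)]; rewrite (negbTE nw).
move=> C C3; apply/idP/idP.
  case/andP=> /andP[_]; rewrite inE negb_and -!ltnNge => h /forallP minC.
  case/orP: h => h.
    have e : C :&: b = C.
      by apply/eqP; rewrite eqEcard subsetIl (leq_trans C3).
    by rewrite e in h; rewrite eqn_leq C3 h -{1}e subsetIr.
  have e : C :\: b = C.
    apply/eqP; apply: contraT => neC; have := minC (C :\: b).
    rewrite properEneq neC subsetDl inE => /andP[_].
    by rewrite setDDl setUid leqNgt h.
  have C2 : 2 <= #|C| by rewrite -e.
  have sC : C \subset ~: b by rewrite -e setDE subsetIr.
  apply/orP; right; rewrite sC andbT eqn_leq C2 andbT leqNgt; apply/negP=> gtC.
  have [D sD cD] := ex_subset_card C2.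
  have := minC D; rewrite properEcard sD cD gtC inE => /andP[_].
  by rewrite (_ : D :\: b = D) ?cD //; apply/setDidPl;
    rewrite disjoints_subset (subset_trans sD).
have small (D : {set T}) : D \proper C -> #|D| < #|C| by apply: proper_card.
case/orP=> /andP[/eqP cC sC]; apply/andP; split.
- rewrite /dependent subsetT inE negb_and -!ltnNge.
  by rewrite (setIidPl sC) cC.
- apply/forallP=> D; apply/implyP=> prD; have := small D prD; rewrite cC ltnS.
  have sD : D \subset b := subset_trans (proper_sub prD) sC.
  rewrite inE (setIidPl sD) => ->; have /eqP-> : D :\: b == set0 by rewrite setD_eq0.
  by rewrite cards0.
- rewrite /dependent subsetT inE negb_and -!ltnNge.
  have /setDidPl-> : [disjoint C & b] by rewrite disjoints_subset.
  by rewrite cC orbT.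
- apply/forallP=> D; apply/implyP=> prD; have := small D prD; rewrite cC ltnS.
  move=> D1; rewrite inE (leq_trans (subset_leq_card (subsetIl _ _))) ?(leqW D1) //.
  by rewrite (leq_trans (subset_leq_card (subsetDl _ _))).
Qed.

End LineDegeneration.

Section PointDegenerations.
Variables (T : finType) (M : matroid T) (i : T).
Hypothesis groundM : ground M = setT.
Implicit Types (A C : {set T}) (N : matroid T).

Definition loop_degeneration_indep := [set A in indep M | i \notin A].

Lemma loop_degeneration_axioms : matroid_axioms setT loop_degeneration_indep.
Proof.
have /and4P[_ h0 h1 h2] := deletion_subproof M i.
by apply/and4P; split=> //; apply/forall_inP=> A _; apply: subsetT.
Qed.

Definition loop_degeneration := Matroid loop_degeneration_axioms.

Lemma is_loop_degenerationE N :
  is_loop_degeneration M i N <-> N = loop_degeneration.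
Proof.
have inD A : A \in indep (deletion M i) = (A \in indep M) && (i \notin A).
  by rewrite inE.
have gD A : A \subset ground (deletion M i) = (i \notin A).
  by rewrite /= groundM subsetD1 subsetT.
split=> [[gN cN]|->].
  apply: matroid_eq => //=; apply/setP=> A; rewrite inE -inD.
  have sA : A \subset ground N by rewrite gN subsetT.
  apply/idP/idP => [/(indep_circuitsP sA) h|IA].
    have iA : i \notin A.
      rewrite -sub1set; apply/negP=> /h/negP[]; apply/cN; by right.
    apply/indep_circuitsP; rewrite ?gD // => C /h; apply: contra => cC.
    by apply/cN; left.
  apply/(indep_circuitsP sA) => C sC; apply/negP=> /cN[].
    by apply/negP; move: C sC; apply/indep_circuitsP; rewrite // (indep_ground IA).
  move=> eC; move: IA; rewrite inD => /andP[_ /negP[]].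
  by rewrite -sub1set -eC.
split=> // C; rewrite /circuit /dependent gD /= subsetT /=.
have [iC|iC] /= := boolP (i \in C); last first.
  split=> [h|[//|eC]]; first by left.
  by rewrite eC set11 in iC.
split=> [/andP[_ /forallP h]|[//|->]].
  right; apply/eqP; apply: contraT => neC; have := h [set i].
  by rewrite properEneq eq_sym neC sub1set iC inE set11 andbF.
rewrite inE set11 andbF /=; apply/forallP=> A; apply/implyP; rewrite properEcard.
by rewrite cards1 ltnS leqn0 cards_eq0 => /andP[_ /eqP->]; rewrite !inE indep0.
Qed.

(** The contraction of M by i with i put back as a coloop: [i |: A] does not see whether i belongs
    to A. *)
Definition coloop_degeneration_indep := [set A : {set T} | i |: A \in indep M].

Hypothesis Ii : [set i] \in indep M.

Lemma coloop_degeneration_axioms : matroid_axioms setT coloop_degeneration_indep.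
Proof.
apply/and4P; split.
- by apply/forall_inP=> A _; apply: subsetT.
- by rewrite inE setU0.
- apply/forall_inP=> A; rewrite inE => IA; apply/forallP=> C.
  by apply/implyP=> sC; rewrite inE (indepS _ IA) // setUS.
- apply/forall_inP=> A; rewrite inE => IA; apply/forall_inP=> C.
  rewrite inE => IC; apply/implyP=> ltAC; apply/exists_inP.
  (* If adding i keeps the strict inequality, M itself provides the new element. Otherwise i lies in
     C and not in A, and i is the new element. *)
  have [ltiAC|] := boolP (#|i |: A| < #|i |: C|).
    have [x [+ + Ix]] := indep_augment IA IC ltiAC.
    rewrite !inE negb_or => h /andP[nxi nxA]; rewrite (negbTE nxi) /= in h.
    by exists x; rewrite !inE ?nxA ?h // setUCA.
  rewrite !cardsU1; have [iC|iC] := boolP (i \in C); last first.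
    by case: (i \in A) => /=; rewrite ?add0n ?add1n ?ltnS ?ltAC // ltnW.
  have [iA|iA] := boolP (i \in A); first by rewrite ltAC.
  by exists i; rewrite !inE ?iA // setUA setUid.
Qed.

Definition coloop_degeneration := Matroid coloop_degeneration_axioms.

Lemma contraction_axioms :
  matroid_axioms (~: [set i]) [set A in coloop_degeneration_indep | i \notin A].
Proof.
have /and4P[_ h0 h1 h2] := deletion_subproof coloop_degeneration i.
apply/and4P; split=> //; apply/forall_inP=> A; rewrite inE => /andP[_ iA].
by rewrite subsetC sub1set inE.
Qed.

Definition contraction := Matroid contraction_axioms.

Lemma singleton_axioms : matroid_axioms [set i] (powerset [set i]).
Proof.
apply/and4P; split.
- by apply/forall_inP=> A; rewrite powersetE.
- by rewrite powersetE sub0set.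
- apply/forall_inP=> A; rewrite powersetE => sA; apply/forallP=> C.
  by apply/implyP=> sC; rewrite powersetE (subset_trans sC).
- apply/forall_inP=> A; rewrite powersetE => sA; apply/forall_inP=> C.
  rewrite powersetE => sC; apply/implyP=> ltAC; apply/exists_inP.
  have /subsetPn[x Cx nAx] : ~~ (C \subset A).
    by apply: contraL ltAC => /subset_leq_card; rewrite -leqNgt.
  exists x; rewrite ?inE ?nAx // subUset sA andbT sub1set.
  exact: (subsetP sC).
Qed.

Definition singleton_matroid := Matroid singleton_axioms.

End PointDegenerations.

Section ColoopDegeneration.
Variables (T : finType) (coll : T -> T -> T -> bool).
Variables (B : {set {set T}}) (M : matroid T).
Hypothesis hP : plane_space coll.
Hypothesis hB : forall b, b \in B <-> exists x y, x != y /\ b = line coll x y.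
Hypothesis hM : is_plane_matroid B M.
Implicit Types (i x y z e f : T) (A C : {set T}) (N : matroid T).

Lemma block_line b x y : b \in B -> x \in b -> y \in b -> x != y ->
  b = line coll x y.
Proof.
move=> /hB[a [a' [aa' ->]]]; rewrite !inE => hx hy xy.
by apply/setP=> z; rewrite !inE (coll_line hP _ aa').
Qed.

Lemma line_block x y : x != y -> line coll x y \in B.
Proof. by move=> xy; apply/hB; exists x, y. Qed.

(** A loopless matroid of rank 2 is determined by its parallel classes. Two points other than i
    share a class [b :\ i] exactly when they are collinear with i, that is, when they are parallel
    in the contraction of M by i. *)
Lemma contraction_indep N2 i :
    ground N2 = ~: [set i] -> rank N2 = 2 -> loopless N2 ->
    parallel_classes N2 = [set b :\ i | b in [set b in B | i \in b]] ->
  indep N2 = [set A in coloop_degeneration_indep M i | i \notin A].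
Proof.
move=> g2 r2 /forallP l2 p2.
have I1 e : e != i -> [set e] \in indep N2.
  move=> ei; have := l2 e; rewrite /loop /dependent g2 negb_and negbK.
  by rewrite sub1set !inE ei.
have I2 x y : x != i -> y != i -> x != y -> indep2 N2 x y = indep3 M i x y.
  move=> xi yi xy; have : parallel_class N2 x \in parallel_classes N2.
    by apply: imset_f; rewrite inE g2 !inE xi l2.
  rewrite p2 => /imsetP[b]; rewrite inE => /andP[Bb ib] /setP eP.
  have := eP x; rewrite !inE g2 !inE xi l2 eqxx /= => /esym bx.
  have ix : i != x by rewrite eq_sym.
  have := eP y; rewrite !inE g2 !inE yi l2 /= eq_sym (negbTE xy) /=.
  rewrite (block_line Bb ib bx ix) inE (plane_indep3 hP hB hM) => <-.
  rewrite /indep2 /dependent xy g2 subUset !sub1set !inE xi yi /=.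
  by rewrite negbK.
apply/setP=> A; rewrite !inE; apply/idP/andP => [IA|[IA iA]].
  have iA : i \notin A.
    apply/negP=> /(subsetP (indep_ground IA)); by rewrite g2 !inE eqxx.
  split=> //; have A2 : #|A| <= 2 by rewrite -r2; apply: leq_rk (indep_ground IA).
  move: A2; rewrite leq_eqVlt => /orP[/cards2P[x [y [xy eA]]]|A1].
    have [xi yi] : x != i /\ y != i.
      by split; apply: contraNneq iA => <-; rewrite eA !inE eqxx ?orbT.
    have := I2 x y xi yi xy; rewrite /indep2 xy -eA IA => /esym/and4P[_ _ _].
    by rewrite eA setUA.
  by apply: (plane_indep_small hP hB hM); rewrite cardsU1 iA.
have := plane_card_indep hM IA; rewrite cardsU1 iA add1n ltnS.
rewrite leq_eqVlt => /orP[/cards2P[x [y [xy eA]]]|].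
  have [xi yi] : x != i /\ y != i.
    by split; apply: contraNneq iA => <-; rewrite eA !inE eqxx ?orbT.
  suff /andP[_] : indep2 N2 x y by rewrite eA.
  rewrite I2 //; apply: (indep3_sub IA); rewrite // ?eA ?inE ?eqxx ?orbT //.
    by rewrite eq_sym.
  by rewrite eq_sym.
rewrite ltnS leq_eqVlt => /orP[/cards1P[e eA]|].
  by rewrite eA; apply: I1; apply: contraNneq iA => <-; rewrite eA inE.
by rewrite ltnS leqn0 cards_eq0 => /eqP->; apply: indep0.
Qed.

Lemma coloop_sum i N1 N2 :
    indep N1 = powerset [set i] ->
    indep N2 = [set A in coloop_degeneration_indep M i | i \notin A] ->
  [set A1 :|: A2 | A1 in indep N1, A2 in indep N2]
    = coloop_degeneration_indep M i.
Proof.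
move=> -> ->; apply/setP=> A; rewrite inE; apply/imset2P/idP => [[A1 A2]|IA].
  rewrite powersetE !inE => sA1 /andP[IA2 _] ->.
  by rewrite setUA (setUidPl sA1).
exists (A :&: [set i]) (A :\ i); last by rewrite setID.
  by rewrite powersetE subsetIr.
by rewrite !inE eqxx andbT (_ : i |: A :\ i = i |: A) // setDE setUIr setUCr setIT.
Qed.

Lemma is_coloop_degenerationE i N :
  is_coloop_degeneration B i N <->
  N = coloop_degeneration (plane_indep1 hP hB hM i).
Proof.
have gM : ground M = setT by case: hM.
split=> [[N1 [N2 [[g1 r1] [g2 r2] l2 p2 [_ gN iN]]]]|->].
  apply: matroid_eq; first by rewrite gN g1 g2 setUCr.
  rewrite iN; apply: coloop_sum; last exact: contraction_indep.
  apply/setP=> A; rewrite powersetE; apply/idP/idP => [/indep_ground|].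
    by rewrite g1.
  have [C [IC sC cC]] := rk_basis N1 (ground N1).
  suff eC : C = [set i] by move=> sA; apply: indepS IC; rewrite eC.
  by apply/eqP; rewrite eqEcard -g1 sC cC -/(rank N1) r1 g1 cards1.
exists (singleton_matroid i), (contraction (plane_indep1 hP hB hM i)).
set N2 := contraction _.
have dep2 x y : x != i -> y != i -> x != y ->
    dependent N2 [set x; y] = coll i x y.
  move=> xi yi xy; rewrite /dependent subsetC sub1set !inE negb_or.
  rewrite (eq_sym i x) (eq_sym i y) xi yi andbT /= -[coll i x y]negbK.
  rewrite -(plane_indep3 hP hB hM) /indep3 (eq_sym i x) (eq_sym i y) xi yi xy.
  by rewrite setUA andbT.
have l2 e : ~~ loop N2 e.
  rewrite /loop /dependent subsetC sub1set !inE; have [//|ei] := eqVneq e i.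
  rewrite /= andbT negbK (plane_indep_small hP hB hM) // cards2.
  by case: (_ != _).
have pc x : x != i -> parallel_class N2 x = line coll i x :\ i.
  move=> xi; apply/setP=> y; rewrite !inE l2 /=; have [//|yi] := eqVneq y i.
  have [->|yx] /= := eqVneq y x; first by rewrite (collxyy hP).
  by rewrite dep2 // eq_sym.
split.
- split=> //; apply/eqP; rewrite eqn_leq; apply/andP; split.
    apply/rk_leqP=> C _ /subset_leq_card; by rewrite cards1.
  by rewrite -(cards1 i); apply: leq_rk; rewrite ?powersetE.
- split=> //; apply/eqP; rewrite eqn_leq; apply/andP; split.
    apply/rk_leqP=> C; rewrite !inE => /andP[IC iC] _.
    by have := plane_card_indep hM IC; rewrite cardsU1 iC add1n ltnS.
  have [x [y [xy nc]]] := line_avoiding hP i; have [_ xi yi] := coll_neq hP nc.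
  have <- : #|[set x; y]| = 2 by rewrite cards2 xy.
  have sN : [set x; y] \subset ground N2.
    by rewrite subUset !sub1set !inE xi yi.
  apply: leq_rk => //; have := dep2 x y xi yi xy; rewrite /dependent sN.
  by rewrite (coll_rot hP) (negbTE nc) => /negbFE.
- exact/forallP.
- apply/setP=> P; apply/imsetP/imsetP => [[x]|[b]].
    rewrite !inE => /andP[xi _] ->; exists (line coll i x); last by rewrite pc.
    by rewrite inE line_block 1?eq_sym // inE (collxyx hP).
  rewrite inE => /andP[Bb ib] ->.
  have [x bx xi] : exists2 x, x \in b & x != i.
    have /hB[a [a' [aa' ->]]] := Bb; have [<-|ai] := eqVneq a i.
      by exists a'; rewrite ?inE ?(collxyy hP) // eq_sym.
    by exists a; rewrite ?inE ?(collxyx hP).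
  exists x; first by rewrite !inE xi l2.
  by rewrite pc // (block_line Bb ib bx) // eq_sym.
- split; first by rewrite disjoints_subset /= setCK.
    by rewrite /= setUCr.
  by rewrite (@coloop_sum i).
Qed.

End ColoopDegeneration.

(** * Matroids below a plane matroid *)

Ltac collinear_perm hP :=
  solve [ done | by rewrite (collC12 hP) | by rewrite (collC23 hP)
        | by rewrite (collC13 hP) | by rewrite (coll_rot hP)
        | by rewrite -(coll_rot hP) ].

(** The aim is a point w where the line through y1 and u meets the line through v and y2, since then
    u, w, v is a chain for R. In an affine plane these lines may be parallel, so a third point t of
    the line u y2 is kept in reserve: R holds from u to t, and at most one of the lines y1 u and y1
    t misses the line v y2. *)
Lemma off_line_connected (T : finType) (coll : T -> T -> T -> bool)
    (R : T -> T -> Prop) (x y y1 y2 : T) :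
    plane_space coll ->
    (forall u v w, R u v -> R v w -> R u w) ->
    x != y -> y1 != y2 -> coll x y y1 -> coll x y y2 ->
    (forall u v, ~~ coll x y u -> ~~ coll x y v ->
      coll u v y1 \/ coll u v y2 -> R u v) ->
  forall u v, ~~ coll x y u -> ~~ coll x y v -> R u v.
Proof.
move=> hP Rtr xy y12 h1 h2 hR u v nu nv.
have onb w : coll y1 y2 w = coll x y w by apply: coll_line.
have meet u' v' w : ~~ coll x y u' -> ~~ coll x y v' ->
    coll y1 u' w -> coll v' y2 w -> R u' v'.
  move=> nu' nv' cu cv; have nw : ~~ coll x y w.
    apply/negP=> cw; have [wy1|wy1] := eqVneq y1 w.
      by case/negP: nv'; rewrite -onb wy1; collinear_perm hP.
    by case/negP: nu'; rewrite -(coll_line hP u' xy wy1) //; collinear_perm hP.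
  by apply: (Rtr _ w); apply: hR => //; [left|right]; collinear_perm hP.
have uy2 : u != y2 by apply: contraNneq nu => ->.
have [t [tu ty2 ct]] := coll_third hP uy2.
have nt : ~~ coll x y t.
  apply/negP=> ct'; case/negP: nu; rewrite -(coll_line hP u xy ty2) //.
  collinear_perm hP.
have Rut : R u t by apply: hR => //; right; collinear_perm hP.
have nvy : ~~ coll v y2 y1 by rewrite -onb in nv; collinear_perm hP.
have nyt : ~~ coll y1 u t.
  apply/negP=> c; case/negP: nu; rewrite -onb.
  have ut : u != t by rewrite eq_sym.
  have c1 : coll u t y1 by collinear_perm hP.
  have c2 : coll u t y2 by collinear_perm hP.
  have := coll_exchange hP ut c1 c2; collinear_perm hP.
have [w /andP[cv /orP[cu|ct']]] := coll_meet hP nvy nyt.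
  exact: meet cu cv.
by apply: (Rtr _ t) => //; apply: meet ct' cv.
Qed.

Section BelowPlane.
Variables (T : finType) (coll : T -> T -> T -> bool).
Variables (B : {set {set T}}) (M N : matroid T).
Hypothesis hP : plane_space coll.
Hypothesis hR : rainbow_rigid coll.
Hypothesis hB : forall b, b \in B <-> exists x y, x != y /\ b = line coll x y.
Hypothesis hM : is_plane_matroid B M.
Hypothesis sNM : indep N \subset indep M.
Hypothesis N1 : forall e, [set e] \in indep N.
Hypothesis N3 : exists2 C, C \in indep N & #|C| = 3.
Implicit Types (x y z w p q : T) (A C : {set T}).

Let below_line :=
  [exists b in B, indep N \subset line_degeneration_indep b].
Let below_coloop :=
  [exists i, indep N \subset coloop_degeneration_indep M i].

Let coll_dep3 x y z : coll x y z -> ~~ indep3 N x y z.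
Proof.
move=> c; apply/negP => /and4P[xy xz yz I].
have := plane_indep3 hP hB hM x y z.
by rewrite /indep3 xy xz yz (subsetP sNM _ I) c.
Qed.

Let ex_indep3 x y : indep2 N x y -> exists z, indep3 N x y z.
Proof.
move=> I2; apply/existsP; apply: contraT; rewrite negb_exists => /forallP h.
have [C IC C3] := N3; suff : #|C| <= 2 by rewrite C3.
by apply: (closure2_rank I2 IC) => w _; apply: h.
Qed.

Lemma simple_below : (forall x y, x != y -> indep2 N x y) -> indep N = indep M.
Proof.
move=> simp; apply/eqP; rewrite eqEsubset sNM; apply/subsetP=> A IA.
have := plane_card_indep hM IA; rewrite leq_eqVlt => /predU1P[/card3P|].
  case=> [x [y [z [xy xz yz eA]]]].
  have nc : ~~ coll x y z.
    by rewrite -(plane_indep3 hP hB hM) /indep3 xy xz yz -eA.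
  suff : indep3 N x y z by rewrite eA => /and4P[].
  apply: contraT => nI; pose X := [set w | ~~ indep3 N x y w].
  have [w I3] := ex_indep3 (simp x y xy).
  have : w \in X; last by rewrite inE I3.
  rewrite (@subspace_full _ _ hP X x y z) ?inE ?indep3xyx ?indep3xyy //.
  move=> a b c; rewrite !inE => ha hb ab cab.
  by rewrite -(indep3_exchange c (simp x y xy) (simp a b ab) ha hb) coll_dep3.
rewrite ltnS leq_eqVlt => /orP[/cards2P[x [y [xy ->]]]|].
  by have /andP[] := simp x y xy.
rewrite ltnS leq_eqVlt => /orP[/cards1P[x ->]|]; first exact: N1.
by rewrite ltnS leqn0 cards_eq0 => /eqP->; apply: indep0.
Qed.

Lemma off_line_parallel x y : x != y ->
    (forall z w, ~~ coll x y z -> ~~ coll x y w -> ~~ indep2 N z w) ->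
  below_line.
Proof.
move=> xy h; apply/exists_inP; exists (line coll x y).
  exact: line_block hB _ _ xy.
apply/subsetP=> A IA; rewrite inE; apply/andP; split; rewrite leqNgt.
  apply/card_gt2P => -[a [b [c [[Aa Ab Ac] [ab bc ca]]]]].
  move: Aa Ab Ac; rewrite !inE => /andP[Aa ha] /andP[Ab hb] /andP[Ac hc].
  have /negP[] : ~~ indep3 N a b c by apply: coll_dep3; rewrite (coll_line hP _ xy).
  by apply: (indep3_sub IA) => //; rewrite eq_sym.
apply/card_gt1P => -[a [b [Aa Ab ab]]].
move: Aa Ab; rewrite !inE => /andP[na Aa] /andP[nb Ab].
by have /negP[] := h a b na nb; apply: (indep2_sub IA).
Qed.

(** Two N-independent points x, y other than i span the N-line through p and z, which misses i. A
    line of M through i, x and y would put i on that N-line, so {i, x, y} is a triangle of M. *)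
Lemma hyperplane_complement p z i :
    indep2 N p z -> indep3 N p z i ->
    (forall w, w != i -> ~~ indep3 N p z w) ->
  below_coloop.
Proof.
move=> Ipz Ii h; apply/existsP; exists i; apply/subsetP=> A IA; rewrite inE.
have IAi : A :\ i \in indep N by apply: indepS IA; apply: subD1set.
have A2 : #|A :\ i| <= 2.
  by apply: (closure2_rank Ipz IAi) => w; rewrite !inE => /andP[/h].
have -> : i |: A = i |: A :\ i by rewrite setDE setUIr setUCr setIT.
move: A2; rewrite leq_eqVlt => /orP[/cards2P[x [y [xy eA]]]|A1]; last first.
  by apply: (plane_indep_small hP hB hM); rewrite cardsU1 !inE eqxx.
have [xi yi] : x != i /\ y != i.
  have: x \in A :\ i by rewrite eA !inE eqxx.
  have: y \in A :\ i by rewrite eA !inE eqxx orbT.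
  by rewrite !inE => /andP[-> _] /andP[-> _].
have Ixy : indep2 N x y by rewrite /indep2 xy -eA.
suff /and4P[_ _ _] : indep3 M i x y by rewrite eA setUA.
rewrite (plane_indep3 hP hB hM); apply/negP=> c.
have /negP[] : ~~ indep3 N x y i by apply: coll_dep3; collinear_perm hP.
by rewrite (indep3_exchange _ Ipz Ixy) // h.
Qed.

Section ParallelPair.
Variables p q : T.
Hypotheses (pq : p != q) (npq : ~~ indep2 N p q).

Let parallelT x y z : ~~ indep2 N x y -> ~~ indep2 N y z -> ~~ indep2 N x z.
Proof. exact: dep2_trans. Qed.

Let classP x y : ~~ indep2 N p x -> ~~ indep2 N p y -> ~~ indep2 N x y.
Proof. by rewrite (indep2C N p x); apply: parallelT. Qed.

(* The three colours are the parallel class of p, the rest of the N-line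
   through p and z, and the complement of that N-line. *)
Let colour z w := if ~~ indep2 N p w then 0 else if indep3 N p z w then 2 else 1.

(** One case per outcome of rigidity. Off a line of M, constant colour 0 makes the points there
    pairwise parallel, and constant colour 2 puts the N-line inside that line. A point alone in its
    colour cannot have colour 0, which p and q share; with colour 1 it is z, which gives the third
    alternative; with colour 2 it is the whole complement of the N-line. *)
Lemma parallel_class_cases z : indep2 N p z ->
  [\/ below_line || below_coloop,
      exists x y, x != y /\ forall w, ~~ indep3 N p z w -> coll x y w
    | forall u w, u != z -> w != z -> coll z u w -> indep2 N p u = indep2 N p w].
Proof.
move=> Ipz.
have I32 w : indep3 N p z w -> indep2 N p w.
  by rewrite indep3C23 => /indep3_indep2.
have c0 w : (colour z w == 0) = ~~ indep2 N p w.
  by rewrite /colour; case: (indep2 N p w) => //; case: ifP.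
have c2 w : (colour z w == 2) = indep3 N p z w.
  rewrite /colour; case: ifP => [nI|_]; last by case: ifP.
  by apply/esym/negbTE; apply: contra nI; apply: I32.
have c1 w : (colour z w == 1) = indep2 N p w && ~~ indep3 N p z w.
  by rewrite /colour; case: (indep2 N p w) => //; case: ifP.
have cz : colour z z = 1 by apply/eqP; rewrite c1 Ipz indep3xyy.
have [w0 Iw0] := ex_indep3 Ipz.
have cp : colour z p = 0 by apply/eqP; rewrite c0 /indep2 eqxx.
have cq : colour z q = 0 by apply/eqP; rewrite c0.
have [||||||] := hR (c := colour z).
- by move=> w; rewrite /colour; case: ifP => // _; case: ifP.
- by exists p.
- by exists z.
- by exists w0; apply/eqP; rewrite c2.
- move=> a b c cab /eqP; rewrite c0 => pa /eqP; rewrite c1 => /andP[pb lb].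
  move=> /eqP; rewrite c2 => Ic.
  have Iab : indep2 N a b.
    by apply: contraLR pb => nab; apply: parallelT nab.
  have /negP[] := coll_dep3 cab; rewrite (indep3_exchange _ Ipz Iab) //.
  by apply: contra pa; apply: I32.
- case=> x [y [k [xy hk]]].
  have [v nv] := coll_off hP xy.
  have : k < 3 by rewrite -(hk v nv) /colour; case: ifP => // _; case: ifP.
  case: k hk => [|[|[|//]]] hk _.
  + constructor 1; apply/orP; left; apply: (off_line_parallel xy) => a b na nb.
    by apply: classP; rewrite -c0 hk.
  (* Here the complement of the N-line L lies inside the line xy of M. If it is one point,
     [hyperplane_complement] applies. Otherwise it contains two points y1 and w0. Independent points
     s, t off xy lie on L and span it, so the line of M through them stays in L and misses y1 and
     w0. Hence points off xy that are collinear with y1 or w0 are parallel, and [off_line_connected]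
     spreads this to all points off xy. *)
  + have {}hk w : ~~ coll x y w -> ~~ indep3 N p z w.
      by move=> /hk/eqP; rewrite c1 => /andP[].
    constructor 1; apply/orP.
    have [/existsP[y1 /andP[y10 I1]]|] :=
      boolP [exists y1, (y1 != w0) && indep3 N p z y1]; last first.
      rewrite negb_exists => /forallP h; right.
      apply: (hyperplane_complement Ipz Iw0) => w ww0.
      by have := h w; rewrite ww0.
    left; apply: (off_line_parallel xy) => a b.
    have on w : indep3 N p z w -> coll x y w by apply: contraLR; apply: hk.
    apply: (off_line_connected (R := fun u v => ~~ indep2 N u v) hP _ xy y10) => //;
      rewrite ?on //.
    move=> s t /hk ns /hk nt h; apply/negP=> Ist.
    by case: h => /coll_dep3/negP[]; rewrite (indep3_exchange _ Ipz Ist).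
  + constructor 2; exists x, y; split=> // w; apply: contraR => /hk/eqP.
    by rewrite c2.
case=> i [hi hl]; have : colour z i < 3.
  by rewrite /colour; case: ifP => // _; case: ifP.
case ci: (colour z i) hi => [|[|[|//]]] hi _.
- by case/eqP: pq; rewrite (hi p cp) (hi q cq).
- constructor 3 => u w uz wz c; have eiz := hi z cz; rewrite -eiz in hl.
  by apply: negb_inj; rewrite -!c0 (hl u w uz wz c).
- constructor 1; apply/orP; right; apply: (@hyperplane_complement p z i) => //.
    by rewrite -c2 ci.
  by move=> w; apply: contra; rewrite -c2 => /eqP/hi ->.
Qed.

Lemma parallel_below : below_line || below_coloop.
Proof.
apply: contraT => nG.
have cases z : indep2 N p z ->
    (exists x y, x != y /\ forall w, ~~ indep3 N p z w -> coll x y w) \/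
    (forall u w, u != z -> w != z -> coll z u w -> indep2 N p u = indep2 N p w).
  by move=> /parallel_class_cases[|h|h]; [rewrite (negbTE nG)|left|right].
have classL z w : indep2 N p z -> ~~ indep2 N p w -> ~~ indep3 N p z w.
  by move=> _; apply: contra; rewrite indep3C23 => /indep3_indep2.
have np : ~~ indep2 N p p by rewrite /indep2 eqxx.
(* Suppose the N-line through p and z, hence the class P of p, lies in a line xy of M, and take z'
   off xy. If the N-line through p and z' also lies in a line of M, both lines of M pass through p
   and q, so they coincide and contain z'. If z' is a centre, a third point t of the line z'p
   belongs to P, so the line tp is xy and contains z'. *)
have centre z : indep2 N p z ->
    forall u w, u != z -> w != z -> coll z u w -> indep2 N p u = indep2 N p w.
  move=> Iz; case: (cases z Iz) => // -[x [y [xy hL]]].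
  have onb w : ~~ indep2 N p w -> coll x y w by move=> pw; apply/hL/classL.
  have [z' nz'] := coll_off hP xy.
  have Iz' : indep2 N p z' by apply: contraR nz'; apply: onb.
  exfalso; case: (cases z' Iz') => [[x' [y' [xy' hL']]]|hc].
    case/negP: nz'; rewrite -(coll_line hP z' xy pq) ?onb //.
    rewrite (coll_line hP z' xy' pq); apply: hL' => //; try exact: classL.
    exact: indep3xyy.
  have z'p : z' != p by apply: contraNneq nz' => ->; apply: onb.
  have [t [tz' tp ct]] := coll_third hP z'p.
  have pt : ~~ indep2 N p t by rewrite -(hc p t) // eq_sym.
  case/negP: nz'; rewrite -(coll_line hP z' xy tp) ?onb //.
  collinear_perm hP.
have [z [w Izw]] : exists z w, indep3 N p z w.
  have [C IC C3] := N3.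
  have [|D [ID + _ D3]] := indep_extend (N1 p) IC; first by rewrite cards1 C3.
  rewrite sub1set => Dp; rewrite C3 in D3.
  have : 1 < #|D :\ p| by move: D3; rewrite (cardsD1 p) Dp add1n => -[->].
  case/card_gt1P=> a [b []]; rewrite !inE => /andP[ap Da] /andP[bp Db] ab.
  by exists a, b; apply: (indep3_sub ID); rewrite // eq_sym.
have Iz := indep3_indep2 Izw.
have Iw : indep2 N p w by move: Izw; rewrite indep3C23 => /indep3_indep2.
have zw : z != w by case/and4P: Izw.
pose X := [set u | indep2 N p u].
(* As every point of X is a centre, X is closed under the lines of M. It misses p, so it contains no
   triangle and lies on the line zw. *)
have clX a b c : a \in X -> b \in X -> a != b -> coll a b c -> c \in X.
  rewrite !inE => Ia Ib ab cab; have [->//|ca] := eqVneq c a.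
  by rewrite -(centre a Ia b c) // eq_sym.
case/negP: nG; apply/orP; left; apply: (off_line_parallel zw).
have offP u : ~~ coll z w u -> ~~ indep2 N p u.
  apply: contra => Iu; apply: contraT => nc.
  have /setP/(_ p) : X = setT by apply: (subspace_full hP clX _ _ _ nc); rewrite inE.
  by rewrite !inE (negbTE np).
by move=> a b /offP pa /offP pb; apply: classP.
Qed.

End ParallelPair.

End BelowPlane.

(** * The degenerations are the maximal elements below M *)

Section MaximalBelow.
Variables (T : finType) (coll : T -> T -> T -> bool).
Variables (B : {set {set T}}) (M : matroid T).
Hypothesis hP : plane_space coll.
Hypothesis hR : rainbow_rigid coll.
Hypothesis hB : forall b, b \in B <-> exists x y, x != y /\ b = line coll x y.
Hypothesis hM : is_plane_matroid B M.
Implicit Types (i j x y z u v : T) (b A C : {set T}) (N : matroid T).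

Let groundM : ground M = setT. Proof. by case: hM. Qed.
Let M1 i := plane_indep1 hP hB hM i.
Let M2 := plane_indep_small hP hB hM.
Let M3 := plane_indep3 hP hB hM.
Let lineB b x y : b \in B -> x \in b -> y \in b -> x != y -> b = line coll x y.
Proof. exact: block_line hP hB b x y. Qed.

Lemma neq_point i : exists j, j != i.
Proof.
have [x [y xy]] := two_points hP; have [<-|] := eqVneq x i; last by exists x.
by exists y; rewrite eq_sym.
Qed.

Lemma block_points b : b \in B -> exists x y, [/\ x \in b, y \in b & x != y].
Proof.
by move=> /hB[x [y [xy ->]]]; exists x, y; rewrite !inE (collxyx hP) (collxyy hP).
Qed.

Lemma block_card b : b \in B -> 2 <= #|b|.
Proof. by move=> /block_points[x [y [bx by_ xy]]]; apply/card_gt1P; exists x, y. Qed.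

Lemma block_proper b : b \in B -> b != setT.
Proof.
move=> /hB[x [y [xy ->]]]; have [z nz] := coll_off hP xy.
by apply: contraNneq nz => /setP/(_ z); rewrite !inE.
Qed.

(** A point a off the line and third points t, s of the lines from a to two of its points are three
    distinct points off the line; at most one of them is i. *)
Lemma block_off b i : b \in B ->
  exists u v, [/\ u \notin b, v \notin b, u != v, u != i & v != i].
Proof.
move=> /hB[x [y [xy ->]]]; have [a na] := coll_off hP xy.
have [_ xa ya] := coll_neq hP na.
have third j : coll x y j -> exists t, [/\ ~~ coll x y t, t != a & coll a j t].
  move=> cj; have aj : a != j by apply: contraNneq na => ->.
  have [t [ta tj ct]] := coll_third hP aj; exists t; split=> //.
  apply: contra na => ct'; rewrite -(coll_line hP a xy tj) //.
  collinear_perm hP.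
have [t [nt ta ct]] := third x (collxyx hP x y).
have [s [ns sa cs]] := third y (collxyy hP x y).
have ts : t != s.
  apply/eqP=> e; subst s; case/negP: na.
  have at_ : a != t by rewrite eq_sym.
  have c1 : coll a t x by collinear_perm hP.
  have c2 : coll a t y by collinear_perm hP.
  have := coll_exchange hP at_ c1 c2; collinear_perm hP.
have [ai|ai] := eqVneq a i; first by exists t, s; rewrite !inE -ai.
have [ti|ti] := eqVneq t i.
  by exists a, s; rewrite !inE -ti !(eq_sym a) sa ta (eq_sym s) ts.
by exists a, t; rewrite !inE (eq_sym a t) ta.
Qed.

(** Such a pair is independent in M_i but parallel in M_b. If i is off b, the pair contains i
    itself. If i is on b, the pair spans a line meeting b in a point j other than i, so that line
    misses i. *)
Lemma block_off_indep b i : b \in B ->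
  exists u v, [/\ u \notin b, v \notin b, u != v & i |: [set u; v] \in indep M].
Proof.
move=> Bb; have [ib|ib] := boolP (i \in b); last first.
  have [v [_ [vb _ _ vi _]]] := block_off i Bb.
  exists i, v; split=> //; first by rewrite eq_sym.
  by rewrite setUA setUid M2 // cards2; case: (_ != _).
have [a [_ [ab _ _ _ _]]] := block_off i Bb.
have [j bj ji] : exists2 j, j \in b & j != i.
  have [x [y [bx by_ xy]]] := block_points Bb.
  have [xi|] := eqVneq x i; last by exists x.
  by exists y; rewrite // -xi eq_sym.
have aj : a != j by apply: contraNneq ab => ->.
have [t [ta tj ct]] := coll_third hP aj.
have off c c' : c \in b -> c' \in b -> c != c' -> a \in b = coll c c' a.
  by move=> bc bc' cc'; rewrite (lineB Bb bc bc' cc') inE.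
exists a, t; split=> //; last 2 first.
- by rewrite eq_sym.
- rewrite setUA; suff /and4P[] : indep3 M i a t by [].
  rewrite M3; apply: contra ab => c; rewrite (off j i) //.
  have at_ : a != t by rewrite eq_sym.
  have c1 : coll a t j by collinear_perm hP.
  have c2 : coll a t i by collinear_perm hP.
  have := coll_exchange hP at_ c1 c2; collinear_perm hP.
apply: contra ab => bt; rewrite (off t j) //; collinear_perm hP.
Qed.

Lemma off_pair_dep b u v : u \notin b -> v \notin b -> u != v ->
  [set u; v] \notin line_degeneration_indep b.
Proof.
move=> ub vb uv; rewrite inE negb_and -!ltnNge; apply/orP; right.
by apply/card_gt1P; exists u, v; rewrite !inE !eqxx ub vb orbT.
Qed.

Lemma coloop_pair_dep i u v : u != i -> v != i -> u != v -> coll i u v ->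
  [set u; v] \notin coloop_degeneration_indep M i.
Proof.
move=> ui vi uv c; rewrite inE setUA; apply/negP=> I.
have := M3 i u v; rewrite /indep3 c uv I.
by rewrite !(eq_sym i) ui vi.
Qed.

Lemma line_degeneration_pair b u v : u \in b ->
  [set u; v] \in line_degeneration_indep b.
Proof.
move=> bu; rewrite inE; apply/andP; split.
  apply: leq_trans (subset_leq_card (subsetIl _ _)) _.
  by rewrite cards2; case: (_ != _).
rewrite -(cards1 v) subset_leq_card //; apply/subsetP=> w; rewrite !inE.
by case/andP=> wb /orP[/eqP e|//]; rewrite e bu in wb.
Qed.

(** In a triangle x, y, i the vertex i is replaced by a third point t of the line xi, which stays
    off the line xy. *)
Lemma triangle_avoiding i :
  exists2 A : {set T}, #|A| = 3 & (A \in indep M) && (i \notin A).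
Proof.
have [x [y [xy nc]]] := line_avoiding hP i; have [_ xi yi] := coll_neq hP nc.
have [t [tx ti ct]] := coll_third hP xi.
have nt : ~~ coll x y t.
  apply: contra nc => ct'; have xt : x != t by rewrite eq_sym.
  have c1 : coll x t y by collinear_perm hP.
  have c2 : coll x t i by collinear_perm hP.
  exact: (coll_exchange hP xt c1 c2).
have [_ xt yt] := coll_neq hP nt.
exists [set x; y; t].
  by rewrite setUC cardsU1 cards2 !inE xy negb_or (eq_sym t y) yt tx.
have := M3 x y t; rewrite nt => /and4P[_ _ _ ->]; rewrite !inE !negb_or.
by rewrite (eq_sym i x) (eq_sym i y) (eq_sym i t) xi yi ti.
Qed.

Variant degeneration : matroid T -> Prop :=
| LineDegeneration b of b \in B : degeneration (line_degeneration b)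
| ColoopDegeneration i : degeneration (coloop_degeneration (M1 i))
| LoopDegeneration i : degeneration (loop_degeneration M i)
| UniformDegeneration : degeneration (uniform T 2).

Lemma degeneration_ground N : degeneration N -> ground N = setT.
Proof. by case. Qed.

Lemma degeneration_indep N : degeneration N -> indep N \subset indep M.
Proof.
case=> [b Bb|i|i|]; apply/subsetP=> A; rewrite inE.
- case/andP=> Ab An.
  have : #|A| <= 3 by rewrite -(cardsID b A) (leq_add Ab An).
  rewrite leq_eqVlt => /predU1P[A3|]; last exact: M2.
  have /card3P[x [y [z [xy xz yz eA]]]] := A3.
  suff : indep3 M x y z by rewrite eA => /and4P[].
  rewrite M3; apply/negP=> c.
  (* At most one of the three points of A is off b, so two are on b. A line of M containing A shares
     them with b and equals b, which contradicts the bound of two points of A on b. *)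
  have /card_gt1P[u [v []]] : 1 < #|A :&: b|.
    by rewrite -(leq_add2r #|A :\: b|) cardsID A3 (leq_add2l 2 _ 1).
  rewrite !inE => /andP[Au bu] /andP[Av bv] uv.
  have sA : A \subset line coll x y.
    by rewrite eA !subUset !sub1set !inE (collxyx hP) (collxyy hP).
  have eb : b = line coll x y.
    rewrite (lineB Bb bu bv uv); apply/esym/lineB => //.
    - exact: line_block hB _ _ xy.
    - exact: (subsetP sA).
    - exact: (subsetP sA).
  by move: Ab; rewrite eb (setIidPl sA) A3.
- by apply: indepS; apply: subsetUr.
- by case/andP.
- exact: M2.
Qed.

Lemma degeneration_neq N : degeneration N -> N <> M.
Proof.
have [i] : exists i : T, true by have [x _] := two_points hP; exists x.
move=> _ [b Bb|j|j|] /(congr1 (@indep T)) /setP eI.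
- have [u [v [ub vb uv _ _]]] := block_off i Bb.
  have := eI [set u; v]; rewrite M2 ?cards2 ?uv //.
  by rewrite (negbTE (off_pair_dep ub vb uv)).
- have [u uj] := neq_point j; have ju : j != u by rewrite eq_sym.
  have [v [vj vu c]] := coll_third hP ju.
  have := eI [set u; v]; rewrite (M2 (A := [set u; v])) ?cards2; last by case: (_ != _).
  by rewrite (negbTE (coloop_pair_dep uj vj _ c)) // eq_sym.
- by have := eI [set j]; rewrite M1 !inE eqxx andbF.
- have [A A3 /andP[IA _]] := triangle_avoiding i.
  by have := eI A; rewrite IA inE A3.
Qed.

(** The type of N' fixes the shape of a small test set that is dependent in N' and, unless N = N',
    can be chosen independent in N: a pair off b' for a line, a pair collinear with j for a coloop,
    the singleton j for a loop, any triple for the uniform matroid. *)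
Lemma degeneration_antichain N N' :
  degeneration N -> degeneration N' -> indep N \subset indep N' -> N = N'.
Proof.
have pair_small u v : #|[set u; v]| <= 2 by rewrite cards2; case: (_ != _).
move=> dN [b' Bb'|j|j|] /subsetP sub.
- have contra_pair u v : u \notin b' -> v \notin b' -> u != v ->
      [set u; v] \in indep N -> N = line_degeneration b'.
    move=> ub vb uv /sub; rewrite (negbTE (off_pair_dep ub vb uv)) //.
  case: dN sub contra_pair => [b Bb|i|i|] sub contra_pair.
  + have [->//|nbb] := eqVneq b b'.
    have [u bu ub'] : exists2 u, u \in b & u \notin b'.
      apply/subsetPn; apply: contra nbb => /subsetP sbb.
      have [x [y [bx by_ xy]]] := block_points Bb.
      by rewrite (lineB Bb bx by_ xy) (lineB Bb' (sbb x bx) (sbb y by_) xy).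
    have [v [_ [vb' _ _ vu _]]] := block_off u Bb'.
    apply: (contra_pair u v) => //; first by rewrite eq_sym.
    exact: line_degeneration_pair.
  + have [u [v [ub vb uv I]]] := block_off_indep i Bb'.
    by apply: (contra_pair u v) => //; rewrite inE.
  + have [u [v [ub vb uv ui vi]]] := block_off i Bb'.
    apply: (contra_pair u v) => //; rewrite !inE M2 ?pair_small // negb_or.
    by rewrite !(eq_sym i) ui vi.
  + have [i _] := two_points hP; have [u [v [ub vb uv _ _]]] := block_off i Bb'.
    by apply: (contra_pair u v) => //; rewrite inE pair_small.
- have contra_pair u v : u != j -> v != j -> v != u -> coll j u v ->
      [set u; v] \in indep N -> N = coloop_degeneration (M1 j).
    move=> uj vj vu c /sub.
    by rewrite (negbTE (coloop_pair_dep uj vj _ c)) // eq_sym.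
  case: dN sub contra_pair => [b Bb|i|i|] sub contra_pair.
  + have [u bu uj] : exists2 u, u \in b & u != j.
      have [x [y [bx by_ xy]]] := block_points Bb.
      have [xj|] := eqVneq x j; last by exists x.
      by exists y; rewrite // -xj eq_sym.
    have ju : j != u by rewrite eq_sym.
    have [v [vj vu c]] := coll_third hP ju.
    by apply: (contra_pair u v) => //; apply: line_degeneration_pair.
  + have [->//|ij] := eqVneq i j; have ji : j != i by rewrite eq_sym.
    have [v [vj vi c]] := coll_third hP ji.
    by apply: (contra_pair i v) => //; rewrite inE setUA setUid M2.
  (* The test pair u, v must avoid i to be independent in M(i), so the line through j carrying it is
     chosen to miss i whenever i differs from j. *)
  + have [u uj nui] : exists2 u, u != j & i != j -> ~~ coll j u i.
      have [->|ij] := eqVneq i j; first by have [u uj] := neq_point j; exists u.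
      have [u nc] := coll_off hP ij; have [_ iu ju] := coll_neq hP nc.
      by exists u => [|_]; [rewrite eq_sym|collinear_perm hP].
    have ju : j != u by rewrite eq_sym.
    have [v [vj vu c]] := coll_third hP ju.
    apply: (contra_pair u v) => //; rewrite !inE M2 //= negb_or.
    have [e|ij] := eqVneq i j; first by rewrite e ju eq_sym.
    have [_ _ ui] := coll_neq hP (nui ij); rewrite eq_sym ui.
    by apply: contraNneq (nui ij) => ->.
  + have [u uj] := neq_point j; have ju : j != u by rewrite eq_sym.
    have [v [vj vu c]] := coll_third hP ju.
    by apply: (contra_pair u v) => //; rewrite inE.
- have contra_loop : [set j] \in indep N -> N = loop_degeneration M j.
    by move=> /sub; rewrite !inE eqxx andbF.
  case: dN sub contra_loop => [b Bb|i|i|] sub contra_loop.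
  + apply: contra_loop; rewrite inE -{2}(cards1 j).
    rewrite (leq_trans (subset_leq_card (subsetIl _ _))) ?cards1 //.
    by rewrite -(cards1 j) subset_leq_card // subsetDl.
  + by apply: contra_loop; rewrite inE M2.
  + have [->//|ij] := eqVneq i j.
    by apply: contra_loop; rewrite !inE M1.
  + by apply: contra_loop; rewrite inE cards1.
have contra_triple A : #|A| = 3 -> A \in indep N -> N = uniform T 2.
  by move=> A3 /sub; rewrite inE A3.
case: dN sub contra_triple => [b Bb|i|i|] sub contra_triple //.
+ have [_ rN _] : is_line_degeneration b (line_degeneration b).
    by apply/is_line_degenerationE; rewrite ?block_card ?block_proper.
  have [C [IC _ C3]] := rk_basis (line_degeneration b) setT.
  by apply: (contra_triple C) => //; rewrite C3.
+ have [x [y [xy nc]]] := line_avoiding hP i; have [_ xi yi] := coll_neq hP nc.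
  apply: (contra_triple [set x; y; i]).
    by rewrite setUC cardsU1 cards2 !inE xy negb_or (eq_sym i x) xi (eq_sym i y) yi.
  rewrite inE [[set x; y; i]]setUC setUA setUid setUC.
  by have := M3 x y i; rewrite nc => /and4P[].
+ have [A A3 /andP[IA iA]] := triangle_avoiding i.
  by apply: (contra_triple A) => //; rewrite !inE IA.
Qed.

Lemma below_degeneration N : ground N = setT -> indep N \subset indep M ->
  N <> M -> exists2 N', degeneration N' & indep N \subset indep N'.
Proof.
move=> gN sNM neq.
have [/forall_inP le2|] := boolP [forall A in indep N, #|A| <= 2].
  exists (uniform T 2); first exact: UniformDegeneration.
  by apply/subsetP=> A /le2; rewrite inE.
rewrite negb_forall_in => /exists_inP[A IA]; rewrite -ltnNge => A3.
have [/forallP N1|] := boolP [forall e, [set e] \in indep N]; last first.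
  rewrite negb_forall => /existsP[e Ne]; exists (loop_degeneration M e).
    exact: LoopDegeneration.
  apply/subsetP=> C IC; rewrite inE (subsetP sNM) //=; apply: contra Ne => eC.
  by apply: indepS IC; rewrite sub1set.
have N3 : exists2 C, C \in indep N & #|C| = 3.
  exists A => //; apply/eqP; rewrite eqn_leq A3 (plane_card_indep hM) //.
  exact: (subsetP sNM).
have [/existsP[p /existsP[q /andP[pq npq]]]|simp] :=
  boolP [exists p, exists q, (p != q) && ~~ indep2 N p q].
  have := parallel_below hP hR hB hM sNM N1 N3 pq npq.
  case/orP=> [/exists_inP[b Bb sub]|/existsP[i sub]].
    by exists (line_degeneration b); first exact: LineDegeneration.
  by exists (coloop_degeneration (M1 i)); first exact: ColoopDegeneration.
case: neq; apply: matroid_eq; first by rewrite gN groundM.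
apply: (simple_below hP hB hM sNM N1 N3) => x y xy; apply: contraR simp => nI.
by apply/existsP; exists x; apply/existsP; exists y; rewrite xy.
Qed.

(** The degenerations form an antichain below M, and every N < M lies below one of them; such an
    antichain is the set of maximal elements. *)
Lemma maximal_belowE N : maximal_below M N <-> degeneration N.
Proof.
have le := weak_leP groundM.
have lt N' : degeneration N' -> weak_lt N' M.
  move=> dN; split; last exact: degeneration_neq.
  by apply/le; [exact: degeneration_ground|exact: degeneration_indep].
split=> [[[leN neN] maxN]|dN].
  have gN : ground N = setT by case: leN => ->.
  have [|N' dN' sub] := below_degeneration gN _ neN; first exact/le.
  rewrite -(maxN N' (lt N' dN')) //.
  by apply/weak_leP; rewrite ?(degeneration_ground dN').
have gN := degeneration_ground dN; split=> [|N' [leN' neN'] leNN']; first exact: lt.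
have gN' : ground N' = setT by case: leN' => ->.
have [|N'' dN'' sub] := below_degeneration gN' _ neN'; first exact/le.
have sub' : indep N \subset indep N' by apply/weak_leP.
apply: matroid_eq; first by rewrite gN gN'.
apply/eqP; rewrite eqEsubset sub' andbT.
by rewrite (degeneration_antichain dN dN'' (subset_trans sub' sub)).
Qed.

Theorem plane_maximal_below :
  [/\ forall b, b \in B -> exists! N, is_line_degeneration b N,
      forall i, exists! N, is_coloop_degeneration B i N,
      forall i, exists! N, is_loop_degeneration M i N
    & forall N : matroid T,
        maximal_below M N <->
        [\/ exists2 b, b \in B & is_line_degeneration b N,
            exists i, is_coloop_degeneration B i N,
            exists i, is_loop_degeneration M i N
          | N = uniform T 2]].
Proof.
have lineE b N : b \in B ->
    is_line_degeneration b N <-> N = line_degeneration b.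
  by move=> Bb; apply: is_line_degenerationE; rewrite ?block_card ?block_proper.
have coloopE i N : is_coloop_degeneration B i N <-> N = coloop_degeneration (M1 i).
  exact: is_coloop_degenerationE.
have loopE i N : is_loop_degeneration M i N <-> N = loop_degeneration M i.
  exact: is_loop_degenerationE.
split=> [b Bb|i|i|N].
- exists (line_degeneration b); split=> [|N]; first exact/lineE.
  by move/lineE => ->.
- exists (coloop_degeneration (M1 i)); split=> [|N]; first exact/coloopE.
  by move/coloopE => ->.
- exists (loop_degeneration M i); split=> [|N]; first exact/loopE.
  by move/loopE => ->.
split=> [/maximal_belowE[b Bb|i|i|]|h].
- by constructor 1; exists b => //; apply/lineE.
- by constructor 2; exists i; apply/coloopE.
- by constructor 3; exists i; apply/loopE.
- by constructor 4.
apply/maximal_belowE; case: h => [[b Bb h]|[i h]|[i h]|->].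
- have -> : N = line_degeneration b by apply/lineE.
  exact: LineDegeneration.
- have -> : N = coloop_degeneration (M1 i) by apply/coloopE.
  exact: ColoopDegeneration.
- have -> : N = loop_degeneration M i by apply/loopE.
  exact: LoopDegeneration.
- exact: UniformDegeneration.
Qed.

End MaximalBelow.

(** * Rigidity by exhaustive search *)

Section Model.
Variables (q : nat) (add mul : nat -> nat -> nat).
Variable pts : seq (nat * nat * nat).
Implicit Types (m n : nat * nat * nat).

Definition model_comb x y m n :=
  (add (mul x m.1.1) (mul y n.1.1), add (mul x m.1.2) (mul y n.1.2),
   add (mul x m.2) (mul y n.2)).

Definition model_pt k := nth (0, 0, 0) pts k.

(** Points are stored as one representative vector each. The representative of c need not be
    rescaled, because the coefficients x and y absorb the factor. *)
Definition model_coll a b c :=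
  (a == b) ||
  has (fun x => has (fun y =>
    model_comb x y (model_pt a) (model_pt b) == model_pt c) (iota 0 q)) (iota 0 q).

(** The last conjunct says that no point is a multiple of another: with second coefficient 0,
    [model_comb] is x times the vector of b. *)
Definition model_wf :=
  [&& all (fun m => [&& m.1.1 < q, m.1.2 < q & m.2 < q]) pts,
      take 3 pts == [:: (1, 0, 0); (0, 1, 0); (0, 0, 1)]
    & all (fun a => all (fun b => (a == b) ||
        all (fun x => model_comb x 0 (model_pt b) (model_pt b) != model_pt a)
          (iota 0 q)) (iota 0 (size pts))) (iota 0 (size pts))].

(** Collinearity is tabulated so that the search performs lookups only. *)
Definition model_table :=
  let d := size pts in
  mkseq (fun a => mkseq (fun b => mkseq (model_coll a b) d) d) d.

End Model.

Definition lookup (t : seq (seq (seq bool))) a b c :=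
  nth false (nth [::] (nth [::] t a) b) c.

(* By homogeneity it is enough to test the axioms at the points 0, 1 and 2. *)
Definition plane_check d (C : nat -> nat -> nat -> bool) :=
  [&& all (fun a => all (fun b => (a == b) ||
        has (fun c => ~~ C a b c) (iota 0 d)) (iota 0 d)) (iota 0 d),
      C 0 1 0,
      all (fun k => (C 0 1 k == C 1 0 k) && (C 0 1 k == C 0 k 1)) (iota 0 d),
      all (fun z => all (fun w => C 0 1 z ==> C 0 1 w ==> C 0 z w)
        (iota 0 d)) (iota 0 d),
      has (fun k => [&& k != 0, k != 1 & C 0 1 k]) (iota 0 d)
    & all (fun w => all (fun w' => C 2 w w' ||
        has (fun u => C 0 1 u && (C 2 w u || C 2 w' u)) (iota 0 d))
        (iota 0 d)) (iota 0 d)].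

Definition rigid_colouring d (C : nat -> nat -> nat -> bool) (s : seq nat) :=
  has (fun a => has (fun b => (a != b) && has (fun k =>
    all (fun z => C a b z || (nth 0 s z == k)) (iota 0 d)) [:: 0; 1; 2])
    (iota 0 d)) (iota 0 d) ||
  has (fun i => all (fun z => (nth 0 s z == nth 0 s i) ==> (z == i)) (iota 0 d)
    && all (fun z => all (fun w => [|| z == i, w == i, ~~ C i z w
                                     | nth 0 s z == nth 0 s w])
             (iota 0 d)) (iota 0 d)) (iota 0 d).

(** The point about to receive colour k has index [size s]. Only triples ending in it are tested;
    lines among earlier points are left to earlier stages. *)
Definition rainbow_last (C : nat -> nat -> nat -> bool) (s : seq nat) k :=
  has (fun a => has (fun b => C a b (size s) && uniq [:: nth 0 s a; nth 0 s b; k])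
    (iota 0 (size s))) (iota 0 (size s)).

(* [if], since the strict evaluation of [||] would not prune the search. *)
Fixpoint rainbow_search d (C : nat -> nat -> nat -> bool) n (s : seq nat) :=
  if n is n'.+1 then
    all (fun k => if rainbow_last C s k then true
                  else rainbow_search d C n' (rcons s k)) [:: 0; 1; 2]
  else rigid_colouring d C s.

(** The proof follows the branch of the search that spells out [col]: s stays a prefix of it, and no
    pruning occurs there because a pruned prefix exhibits a rainbow line. *)
Lemma rainbow_search_sound d (C : nat -> nat -> nat -> bool) (col : seq nat) n s :
    size col = d -> all (fun k => k < 3) col ->
    (forall a b c, a < d -> b < d -> c < d -> C a b c ->
       ~~ uniq [:: nth 0 col a; nth 0 col b; nth 0 col c]) ->
    s = take (size s) col -> size s + n = d -> rainbow_search d C n s ->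
  rigid_colouring d C col.
Proof.
move=> szc c3 norb; elim: n s => [|n IHn] s es; rewrite ?addn0 ?addnS => sz.
  by rewrite es take_oversize // szc sz.
have lts : size s < size col by rewrite szc -sz ltnS leq_addr.
set k := nth 0 col (size s); have es' : rcons s k = take (size s).+1 col.
  by rewrite (take_nth 0) // -es.
have k3 : k < 3 by apply: all_nthP c3 _ lts.
case/and4P=> h0 h1 h2 _.
have : if rainbow_last C s k then true else rainbow_search d C n (rcons s k).
  by case: {es'} (k) k3 => [|[|[|]]].
case: ifP => [|_]; last first.
  by apply: IHn; rewrite size_rcons // -sz.
case/hasP=> a; rewrite mem_iota => /andP[_ lta] /hasP[b]; rewrite mem_iota.
have ns x : x < size s -> nth 0 s x = nth 0 col x.
  by move=> ltx; rewrite {1}es nth_take.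
case/andP=> _ ltb /andP[cab]; rewrite !ns // => u.
have szd : size s < d by rewrite -szc.
have := norb a b (size s); rewrite -/k u (ltn_trans lta szd) (ltn_trans ltb szd).
by move=> /(_ isT isT szd cab).
Qed.

Definition model_check q add mul pts :=
  model_wf q add mul pts &&
  (let d := size pts in let t := model_table q add mul pts in
   plane_check d (lookup t) &&
   rainbow_search d (lookup t) (d - 3) [:: 0; 1; 2]).

Definition triples q : seq (nat * nat * nat) :=
  [seq (m, c) | m <- [seq (a, b) | a <- iota 0 q, b <- iota 0 q], c <- iota 0 q].

(** With the basis in front, the indices 0, 1, 2 are the triangle to which all triangles are
    moved. *)
Definition with_basis (s : seq (nat * nat * nat)) :=
  let e := [:: (1, 0, 0); (0, 1, 0); (0, 0, 1)] in
  e ++ [seq m <- s | m \notin e].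

(* Homogeneous coordinates, with leading coefficient 1. *)
Definition PG_points q :=
  with_basis [seq m <- triples q |
    if m.1.1 == 0 then if m.1.2 == 0 then m.2 == 1 else m.1.2 == 1
    else m.1.1 == 1].

(* Barycentric coordinates. *)
Definition AG_points q (add : nat -> nat -> nat) :=
  with_basis [seq m <- triples q | add (add m.1.1 m.1.2) m.2 == 1].

Definition add_mod q a b := (a + b) %% q.
Definition mul_mod q a b := (a * b) %% q.

(* 0, 1, w, w + 1 with w ^ 2 = w + 1. *)
Definition add4 a b := nth 0 (nth [::] [:: [:: 0; 1; 2; 3]; [:: 1; 0; 3; 2];
  [:: 2; 3; 0; 1]; [:: 3; 2; 1; 0]] a) b.
Definition mul4 a b := nth 0 (nth [::] [:: [:: 0; 0; 0; 0]; [:: 0; 1; 2; 3];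
  [:: 0; 2; 3; 1]; [:: 0; 3; 1; 2]] a) b.

Lemma PG2_check : model_check 2 (add_mod 2) (mul_mod 2) (PG_points 2).
Proof. by vm_compute. Qed.

Lemma PG3_check : model_check 3 (add_mod 3) (mul_mod 3) (PG_points 3).
Proof. by vm_compute. Qed.

Lemma AG3_check : model_check 3 (add_mod 3) (mul_mod 3) (AG_points 3 (add_mod 3)).
Proof. by vm_compute. Qed.

Lemma AG4_check : model_check 4 add4 mul4 (AG_points 4 add4).
Proof. by vm_compute. Qed.

(** * Coordinates *)

Import GRing.Theory.
Local Open Scope ring_scope.

Record field_code (F : fieldType) (q : nat) (add mul : nat -> nat -> nat)
    (el : nat -> F) : Prop := FieldCode {
  code0 : el 0%N = 0;
  code1 : el 1%N = 1;
  code_gt1 : (1 < q)%N;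
  code_inj : forall a b, (a < q)%N -> (b < q)%N -> el a = el b -> a = b;
  code_surj : forall x, exists2 a, (a < q)%N & el a = x;
  code_add : forall a b, (a < q)%N -> (b < q)%N ->
    (add a b < q)%N /\ el (add a b) = el a + el b;
  code_mul : forall a b, (a < q)%N -> (b < q)%N ->
    (mul a b < q)%N /\ el (mul a b) = el a * el b }.

(** The common form of both geometries: V k is a spanning vector of a projective point, or the lift
    of an affine point to height 1. *)
Definition span_coll (F : finFieldType) (vT : vectType F) (I : eqType)
    (V : I -> vT) (i j k : I) : bool :=
  (i == j) || [exists a : F, exists b : F, V k == a *: V i + b *: V j].

Section Coordinates.
Variables (F : finFieldType) (q : nat) (add mul : nat -> nat -> nat).
Variables (el : nat -> F) (pts : seq (nat * nat * nat)) (d : nat).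
Hypothesis hel : field_code q add mul el.
Hypothesis hwf : model_wf q add mul pts.
Hypothesis szp : size pts = d.
Variables (vT : vectType F) (V : 'I_d -> vT).
Hypothesis Vfree : forall i j a b,
  i != j -> a *: V i + b *: V j = 0 -> a = 0 /\ b = 0.
Variables i0 i1 i2 : 'I_d.
Hypothesis tri : ~~ span_coll V i0 i1 i2.

Definition coord_vector (m : nat * nat * nat) : vT :=
  el m.1.1 *: V i0 + el m.1.2 *: V i1 + el m.2 *: V i2.

Hypothesis hpts : forall m, m \in pts ->
  exists i, exists2 c, c != 0 & coord_vector m = c *: V i.

Let neq01 : i0 != i1.
Proof. by apply: contraNneq tri => e; rewrite /span_coll e eqxx. Qed.

Lemma triangle_free a b c :
  a *: V i0 + b *: V i1 + c *: V i2 = 0 -> [/\ a = 0, b = 0 & c = 0].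
Proof.
move=> e; have c0 : c = 0.
  apply/eqP; apply: contraNT tri => nc; apply/orP; right.
  apply/existsP; exists (- (c^-1 * a)); apply/existsP; exists (- (c^-1 * b)).
  rewrite !scaleNr -opprD -!scalerA -scalerDr -(opprK (a *: _ + _)).
  move/eqP: e; rewrite addr_eq0 => /eqP->.
  by rewrite !scalerN !opprK scalerK.
by move: e; rewrite c0 scale0r addr0 => /(Vfree neq01)[].
Qed.

Definition code_ok (m : nat * nat * nat) :=
  [&& m.1.1 < q, m.1.2 < q & m.2 < q]%N.

Lemma coord_vector_inj m n :
  code_ok m -> code_ok n -> coord_vector m = coord_vector n -> m = n.
Proof.
case: m n => [[a b] c] [[a' b'] c'] /and3P[/= ha hb hc] /and3P[/= ha' hb' hc'].
rewrite /coord_vector /= => /eqP; rewrite -subr_eq0 => /eqP.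
rewrite !opprD addrACA (addrACA (el a *: V i0)).
rewrite -!scalerBl => /triangle_free[/eqP ea /eqP eb /eqP ec].
rewrite !subr_eq0 in ea eb ec.
by rewrite (code_inj hel ha ha' (eqP ea)) (code_inj hel hb hb' (eqP eb))
  (code_inj hel hc hc' (eqP ec)).
Qed.

Lemma coord_vector_comb x y m n :
    (x < q)%N -> (y < q)%N -> code_ok m -> code_ok n ->
  code_ok (model_comb add mul x y m n) /\
  coord_vector (model_comb add mul x y m n)
    = el x *: coord_vector m + el y *: coord_vector n.
Proof.
case: m n => [[a b] c] [[a' b'] c'] hx hy /and3P[/= ha hb hc] /and3P[/= ha' hb' hc'].
have lin s t : (s < q)%N -> (t < q)%N ->
    (add (mul x s) (mul y t) < q)%N /\
    el (add (mul x s) (mul y t)) = el x * el s + el y * el t.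
  move=> hs ht; have [ls es] := code_mul hel hx hs.
  have [lt et] := code_mul hel hy ht; have [l e] := code_add hel ls lt.
  by rewrite e es et.
have [la ea] := lin a a' ha ha'; have [lb eb] := lin b b' hb hb'.
have [lc ec] := lin c c' hc hc'; split; first by rewrite /code_ok /= la lb lc.
rewrite /coord_vector /= ea eb ec !scalerDr !scalerDl !scalerA.
by rewrite [RHS]addrACA (addrACA ((el x * el a) *: V i0)).
Qed.

Let pt k := model_pt pts k.

Let pt_ok k : (k < d)%N -> code_ok (pt k).
Proof.
by rewrite -szp => ltk; case/and3P: hwf => /allP h _ _; apply: h; apply: mem_nth.
Qed.

Let pt_anchor :
  [/\ (2 < d)%N, pt 0 = (1, 0, 0)%N, pt 1 = (0, 1, 0)%N & pt 2 = (0, 0, 1)%N].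
Proof.
case/and3P: hwf => _ /eqP h _; rewrite /pt /model_pt -szp.
by case: (pts) h => [|m0 [|m1 [|m2 s]]] //= [-> -> ->].
Qed.

(** Each model point, read as coordinates in the basis given by the triangle, yields a multiple of
    some V i. No two model points are proportional, so this assignment is injective; it is bijective
    because both sides have d points, and h is its inverse. *)
Lemma anchored_coordinates :
  exists h : 'I_d -> 'I_d,
    [/\ bijective h, val (h i0) = 0%N, val (h i1) = 1%N, val (h i2) = 2%N
      & forall x y z,
          span_coll V x y z = model_coll q add mul pts (h x) (h y) (h z)].
Proof.
have [d2 p0 p1 p2] := pt_anchor.
have /fin_all_exists[g hg] : forall k : 'I_d, exists i,
    exists2 c, c != 0 & coord_vector (pt k) = c *: V i.
  by move=> k; apply: hpts; apply: mem_nth; rewrite szp.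
have g_inj : injective g.
  move=> a b eg; apply/val_inj/eqP; apply: contraT => nab.
  have [c nc ea] := hg a; have [c' nc' eb] := hg b; rewrite eg in ea.
  (* x codes the factor by which the vector of b would have to be scaled to give that of a, which
     [model_wf] forbids. *)
  have [x ltx ex] := code_surj hel (c / c').
  have q0 : (0 < q)%N by apply: ltnW (code_gt1 hel).
  have [ok e] := coord_vector_comb ltx q0 (pt_ok (ltn_ord b)) (pt_ok (ltn_ord b)).
  case/and3P: hwf => _ _ /allP/(_ (val a)).
  rewrite mem_iota szp ltn_ord => /(_ isT)/allP/(_ (val b)).
  rewrite mem_iota ltn_ord => /(_ isT); rewrite (negbTE nab) /=.
  move/allP/(_ x); rewrite mem_iota ltx => /(_ isT)/eqP[].
  apply: coord_vector_inj; rewrite ?pt_ok // e ex (code0 hel) scale0r addr0.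
  by rewrite ea eb scalerA divfK.
have g_bij : bijective g by apply: injF_bij.
have coll_g a b c : span_coll V (g a) (g b) (g c) = model_coll q add mul pts a b c.
  rewrite /span_coll /model_coll (inj_eq g_inj) -val_eqE /=.
  have [ab|ab] //= := eqVneq (val a) (val b).
  have [ca nca ea] := hg a; have [cb ncb eb] := hg b; have [cc ncc ec] := hg c.
  apply/existsP/hasP => [[x /existsP[y /eqP e]]|[x + /hasP[y]]].
    have [x' ltx ex] := code_surj hel (cc * x / ca).
    have [y' lty ey] := code_surj hel (cc * y / cb).
    have [ok e'] := coord_vector_comb ltx lty (pt_ok (ltn_ord a)) (pt_ok (ltn_ord b)).
    exists x'; rewrite ?mem_iota //; apply/hasP; exists y'; rewrite ?mem_iota //.
    apply/eqP; apply: coord_vector_inj; rewrite ?pt_ok // e' ex ey ea eb ec e.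
    by rewrite scalerDr !scalerA !divfK.
  rewrite !mem_iota /= !add0n => ltx lty /eqP e.
  have [ok e'] := coord_vector_comb ltx lty (pt_ok (ltn_ord a)) (pt_ok (ltn_ord b)).
  exists (el x * ca / cc); apply/existsP; exists (el y * cb / cc).
  move: e'; rewrite -/(pt a) e [coord_vector _]ec ea eb => e'.
  apply/eqP; apply: (scalerI ncc); rewrite e' scalerDr !scalerA.
  by rewrite ![cc * _]mulrC !divfK.
have [h gK hK] := g_bij.
have anchor (k : 'I_d) i : coord_vector (pt k) = V i -> h i = k.
  move=> e; apply: (can_inj gK); rewrite hK; apply/eqP; apply: contraT => nik.
  have [c nc ek] := hg k; move/eqP: ek; rewrite e -subr_eq0 -scaleNr -[V i]scale1r.
  by move=> /eqP/(Vfree nik)[/eqP]; rewrite oner_eq0.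
have e0 := code0 hel; have e1 := code1 hel.
exists h; split.
- by exists g.
- have -> : h i0 = Ordinal (ltnW (ltnW d2)) by apply: anchor;
    rewrite [pt _]p0 /coord_vector /= e0 e1 !scale0r scale1r !addr0.
  by [].
- have -> : h i1 = Ordinal (ltnW d2) by apply: anchor;
    rewrite [pt _]p1 /coord_vector /= e0 e1 !scale0r scale1r addr0 add0r.
  by [].
- have -> : h i2 = Ordinal d2 by apply: anchor;
    rewrite [pt _]p2 /coord_vector /= e0 e1 !scale0r scale1r !add0r.
  by [].
by move=> x y z; rewrite -coll_g !hK.
Qed.

End Coordinates.

Local Close Scope ring_scope.

(** * Transfer from the numerical model to the plane *)

Section Homogeneous.
Variables (d : nat) (coll : 'I_d -> 'I_d -> 'I_d -> bool).
Variable C : nat -> nat -> nat -> bool.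
Hypothesis homog : forall x y z, ~~ coll x y z ->
  exists h : 'I_d -> 'I_d,
    [/\ bijective h, val (h x) = 0, val (h y) = 1, val (h z) = 2
      & forall u v w, coll u v w = C (h u) (h v) (h w)].
Hypothesis tri : exists x y z, ~~ coll x y z.
Hypothesis collxx : forall x z, coll x x z.
Hypothesis hC : plane_check d C.

Let all_ord (p : pred nat) (k : 'I_d) : all p (iota 0 d) -> p k.
Proof. by move=> /allP; apply; rewrite mem_iota ltn_ord. Qed.

Let has_ord (p : pred nat) (h : 'I_d -> 'I_d) :
  bijective h -> has p (iota 0 d) -> exists x, p (h x).
Proof.
case=> g _ gK /hasP[k]; rewrite mem_iota => /andP[_ ltk] pk.
by exists (g (Ordinal ltk)); rewrite gK.
Qed.

Lemma homogeneous_off x y : x != y -> exists z, ~~ coll x y z.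
Proof.
have [a [b [c /homog[h [hb _ _ _ e]]]]] := tri; move=> xy.
case/and5P: hC => /(all_ord (h x))/(all_ord (h y)) + _ _ _ _.
rewrite val_eqE (inj_eq (bij_inj hb)) (negbTE xy) /= => /(has_ord hb)[z nc].
by exists z; rewrite e.
Qed.

Let anchor2 x y : x != y -> exists h : 'I_d -> 'I_d,
    [/\ bijective h, val (h x) = 0, val (h y) = 1
      & forall u v w, coll u v w = C (h u) (h v) (h w)].
Proof.
by move=> /homogeneous_off[z /homog[h [hb h0 h1 _ e]]]; exists h.
Qed.

Lemma homogeneous_plane_space : plane_space coll.
Proof.
case/and5P: hC => _ c010 sym exch /andP[third meet].
have collxyx x y : coll x y x.
  have [->|/anchor2[h [_ h0 h1 e]]] := eqVneq x y; first exact: collxx.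
  by rewrite e h0 h1.
split=> //.
- have [x [y [z n]]] := tri; exists x, y; apply: contraNneq n => ->.
  exact: collxx.
- move=> x y z; have [->//|/anchor2[h [_ h0 h1 e]]] := eqVneq x y.
  by rewrite !e h0 h1; have /andP[/eqP] := all_ord (h z) sym.
- move=> x y z; have [->|/anchor2[h [_ h0 h1 e]]] := eqVneq x y.
    by rewrite collxyx collxx.
  by rewrite !e h0 h1; have /andP[_ /eqP] := all_ord (h z) sym.
- move=> x y z w /anchor2[h [_ h0 h1 e]]; rewrite !e h0 h1 => cz cw.
  by have := all_ord (h w) (all_ord (h z) exch); rewrite cz cw.
- move=> x y /anchor2[h [hb h0 h1 e]].
  have [z /and3P[z0 z1 cz]] := has_ord hb third.
  exists z; rewrite e h0 h1 cz; split=> //.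
    by apply: contraNneq z0 => ->; rewrite h0.
  by apply: contraNneq z1 => ->; rewrite h1.
- exact: homogeneous_off.
- move=> x y z w w' /homog[h [hb h0 h1 h2 e]]; rewrite !e h2 => nc.
  have := all_ord (h w') (all_ord (h w) meet); rewrite (negbTE nc) /=.
  by case/(has_ord hb)=> u cu; exists u; rewrite !e h0 h1 h2.
Qed.

(** Points of colours 0, 1, 2 are carried to the indices 0, 1, 2, so the colouring listed along the
    model starts with 0, 1, 2, which is the prefix given to the search. *)
Lemma homogeneous_rainbow_rigid :
  rainbow_search d C (d - 3) [:: 0; 1; 2] -> rainbow_rigid coll.
Proof.
move=> hs c c3 [x0 cx0] [x1 cx1] [x2 cx2] norb.
have hP := homogeneous_plane_space.
have norb' x y z : coll x y z -> ~~ uniq [:: c x; c y; c z].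
  move=> cxyz; apply/negP; have := c3 x; have := c3 y; have := c3 z.
  case cx: (c x) => [|[|[|//]]]; case cy: (c y) => [|[|[|//]]];
  case cz: (c z) => [|[|[|//]]] //= _ _ _ _.
  - exact: (norb x y z).
  - by apply: (norb x z y) => //; rewrite (collC23 hP).
  - by apply: (norb y x z) => //; rewrite (collC12 hP).
  - by apply: (norb z x y) => //; rewrite (coll_rot hP).
  - by apply: (norb y z x) => //; rewrite -(coll_rot hP).
  - by apply: (norb z y x) => //; rewrite (collC13 hP).
have nc : ~~ coll x0 x1 x2 by apply/negP=> /norb; apply.
have [h [hb h0 h1 h2 e]] := homog nc; have [g hK gK] := hb.
have d2 : 2 < d by rewrite -h2 ltn_ord.
have [k0 k1 k2] : [/\ g (Ordinal (ltnW (ltnW d2))) = x0,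
    g (Ordinal (ltnW d2)) = x1 & g (Ordinal d2) = x2].
  by split; apply: (can_inj hK); rewrite gK; apply: val_inj.
pose col := [seq c (g k) | k <- enum 'I_d].
have szc : size col = d by rewrite size_map size_enum_ord.
have nthc (k : 'I_d) : nth 0 col k = c (g k).
  by rewrite (nth_map k) ?size_enum_ord // nth_ord_enum.
have nthh x : nth 0 col (h x) = c x by rewrite nthc hK.
have : rigid_colouring d C col.
  apply: rainbow_search_sound hs => //.
  - by apply/allP=> k /mapP[j _ ->].
  - move=> a b k la lb lk cabk.
    rewrite -[a]/(val (Ordinal la)) -[b]/(val (Ordinal lb)) -[k]/(val (Ordinal lk)).
    by rewrite !nthc; apply: norb'; rewrite e !gK.
  - apply: (@eq_from_nth _ 0) => [|[|[|[|//]]]] /=;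
      rewrite ?size_takel ?szc // => _; rewrite nth_take //.
    + by rewrite -[0]/(val (Ordinal (ltnW (ltnW d2)))) nthc k0 cx0.
    + by rewrite -[1]/(val (Ordinal (ltnW d2))) nthc k1 cx1.
    + by rewrite -[2]/(val (Ordinal d2)) nthc k2 cx2.
  - by rewrite subnKC.
have hi := bij_inj hb.
case/orP=> [/(has_ord hb)[x]/(has_ord hb)[y]/andP[xy /hasP[k _ hk]]|].
  left; exists x, y, k; split=> [|z]; first by apply: contraNneq xy => ->.
  rewrite e => nz; have := all_ord (h z) hk.
  by rewrite (negbTE nz) nthh => /eqP.
case/(has_ord hb)=> i /andP[single mono]; right; exists i; split=> [z ez|z w zi wi].
  have := all_ord (h z) single; rewrite !nthh ez eqxx val_eqE => /eqP/hi //.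
rewrite e => cizw; have := all_ord (h w) (all_ord (h z) mono).
by rewrite !val_eqE !(inj_eq hi) (negbTE zi) (negbTE wi) cizw !nthh => /eqP.
Qed.

End Homogeneous.

Lemma lookup_table q add mul pts a b c :
    a < size pts -> b < size pts -> c < size pts ->
  lookup (model_table q add mul pts) a b c = model_coll q add mul pts a b c.
Proof. by move=> ha hb hc; rewrite /lookup !nth_mkseq. Qed.

Local Open Scope ring_scope.

(** * Numerical codes for the finite fields involved *)

Lemma code_surj_card (F : finFieldType) q (el : nat -> F) :
    #|F| = q ->
    (forall a b, (a < q)%N -> (b < q)%N -> el a = el b -> a = b) ->
  forall x, exists2 a, (a < q)%N & el a = x.
Proof.
move=> cF el_inj x; pose f (a : 'I_q) := el a.
have f_inj : injective f by move=> a b /el_inj e; apply/val_inj/e.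
have /codomP[a ->] : x \in codom f by apply: inj_card_onto; rewrite // cF card_ord.
by exists a.
Qed.

Lemma prime_field_code (F : finFieldType) p : prime p -> #|F| = p ->
  field_code p (add_mod p) (mul_mod p) (fun a => a%:R : F).
Proof.
move=> pr cF; have ch : p \in [pchar F].
  by apply: (@card_finPcharP _ p 1); rewrite // expn1.
have natr_mod a : (a %% p)%:R = a%:R :> F.
  by rewrite {2}(divn_eq a p) natrD natrM (pcharf0 ch) mulr0 add0r.
have inj (a b : nat) : (a < p)%N -> (b < p)%N -> a%:R = b%:R :> F -> a = b.
  wlog le_ab : a b / (a <= b)%N => [hw ha hb e|_ hb /eqP].
    by case/orP: (leq_total a b) => le; [apply: hw|apply/esym/hw].
  rewrite eq_sym -subr_eq0 -natrB // -(dvdn_pcharf ch) => dv; apply/eqP.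
  rewrite eqn_leq le_ab -subn_eq0 -leqn0 leqNgt; apply/negP=> gt0.
  by have := dvdn_leq gt0 dv; rewrite leqNgt (leq_ltn_trans (leq_subr _ _)).
split=> //; first exact: prime_gt1.
- exact: code_surj_card.
- by move=> a b _ _; rewrite ltn_mod prime_gt0 // natr_mod natrD.
- by move=> a b _ _; rewrite ltn_mod prime_gt0 // natr_mod natrM.
Qed.

(** For w other than 0 and 1, the elements are 0, 1, w and 1 + w. The square of w is 1 + w by
    elimination: 0 or w would give w = 0 or w = 1, and 1 would make the square of 1 + w vanish in
    characteristic 2. *)
Lemma field4_code (F : finFieldType) : #|F| = 4%N ->
  exists el : nat -> F, field_code 4 add4 mul4 el.
Proof.
move=> cF; have ch : 2%N \in [pchar F] by apply: (@card_finPcharP _ 2 2).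
have [w /norP[w0 w1]] : exists w : F, ~~ ((w == 0) || (w == 1)).
  have /subsetPn[w _ nw] : ~~ ([set: F] \subset [set 0; 1]).
    apply/negP=> /subset_leq_card; rewrite cardsT cF.
    by rewrite cards2; case: (_ != _).
  by exists w; move: nw; rewrite !inE.
have xx (x : F) : x + x = 0 by rewrite addrr_pchar2.
have n2 : 2%:R = 0 :> F by rewrite -(pcharf0 ch).
pose el a := nth 0 [:: 0; 1; w; 1 + w] a.
have w10 : 1 + w != 0.
  by apply: contra w1 => /eqP e; rewrite -subr_eq0 (oppr_pchar2 ch) addrC e.
have uq : uniq [:: 0; 1; w; 1 + w].
  rewrite /= !inE !negb_or !(eq_sym 0) oner_eq0 w0 w10 !(eq_sym 1) w1 /=.
  rewrite -subr_eq0 addrAC subrr add0r w0 /=.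
  by rewrite eq_sym -subr_eq0 addrK oner_eq0.
have el_inj a b : (a < 4)%N -> (b < 4)%N -> el a = el b -> a = b.
  by move=> ha hb /eqP; rewrite nth_uniq // => /eqP.
have el_surj := code_surj_card cF el_inj.
have ww : w * w = 1 + w.
  have [[|[|[|[|//]]]] _ /= e] := el_surj (w * w).
  - by move/esym/eqP: e; rewrite mulf_eq0 (negbTE w0).
  - have /eqP : (1 + w) * (1 + w) = 0.
      by rewrite mulrDl mul1r mulrDr mulr1 -e [w + 1]addrC xx.
    by rewrite mulf_eq0 (negbTE w10).
  - have /(mulfI w0)/eqP : w * w = w * 1 by rewrite -e mulr1.
    by rewrite (negbTE w1).
  - by rewrite -e.
have w1w : w * (1 + w) = 1 by rewrite mulrDr mulr1 ww addrCA xx addr0.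
exists el; split=> //.
- move=> [|[|[|[|//]]]] [|[|[|[|//]]]] _ _; split=> //; rewrite /el /=;
    first [by rewrite ?add0r ?addr0 ?xx | by rewrite addrA xx add0r
          | by rewrite addrC | by rewrite addrCA xx addr0
          | by rewrite addrAC xx add0r | by rewrite -addrA xx addr0].
- move=> [|[|[|[|//]]]] [|[|[|[|//]]]] _ _; split=> //; rewrite /el /=;
    first [by rewrite ?mul0r ?mulr0 ?mul1r ?mulr1 | by rewrite ww
          | by rewrite w1w | by rewrite mulrC w1w
          | by rewrite mulrDl mul1r w1w addrAC xx add0r].
Qed.

Lemma span_coll_plane (F : finFieldType) q add mul (el : nat -> F) pts d
    (vT : vectType F) (V : 'I_d -> vT) :
    field_code q add mul el -> model_check q add mul pts -> size pts = d ->
    (forall i j a b, i != j -> a *: V i + b *: V j = 0 -> a = 0 /\ b = 0) ->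
    (exists i j k, ~~ span_coll V i j k) ->
    (forall i j k m, ~~ span_coll V i j k -> m \in pts ->
      exists l, exists2 c, c != 0 & coord_vector el V i j k m = c *: V l) ->
  plane_space (span_coll V) /\ rainbow_rigid (span_coll V).
Proof.
move=> hel /andP[wf /andP[hp hs]] sz Vfree tri hpts; rewrite sz in hp hs.
set C := lookup _ in hp hs.
have homog x y z : ~~ span_coll V x y z -> exists h : 'I_d -> 'I_d,
    [/\ bijective h, val (h x) = 0%N, val (h y) = 1%N, val (h z) = 2%N
      & forall u v w, span_coll V u v w = C (h u) (h v) (h w)].
  move=> nc; have [|h [hb h0 h1 h2 e]] := anchored_coordinates hel wf sz Vfree nc.
    by move=> m; apply: hpts.
  by exists h; split=> // u v w; rewrite e /C lookup_table ?sz.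
have xx x z : span_coll V x x z by rewrite /span_coll eqxx.
split; first exact: homogeneous_plane_space homog tri xx hp.
exact: homogeneous_rainbow_rigid homog tri xx hp hs.
Qed.

Definition coll_lines d (B : {set {set 'I_d}}) coll :=
  forall b, b \in B <-> exists x y, x != y /\ b = line coll x y.

(** * Projective planes through spanning vectors of their points *)

Section Projective.
Variables (F : finFieldType) (d : nat) (B : {set {set 'I_d}}).
Variable phi : 'I_d -> {vspace 'rV[F]_3}.
Hypothesis phi_inj : injective phi.
Hypothesis phi_onto :
  forall U : {vspace 'rV[F]_3}, \dim U = 1%N <-> exists i, phi i = U.
Hypothesis phiB : forall b : {set 'I_d}, b \in B <->
  exists W : {vspace 'rV[F]_3}, \dim W = 2 /\ b = [set i | (phi i <= W)%VS].

Definition proj_vector i := vpick (phi i).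
Let V := proj_vector.

Let phiE i : phi i = <[V i]>%VS.
Proof.
have d1 : \dim (phi i) = 1%N by apply/phi_onto; exists i.
have nz : V i != 0 by rewrite vpick0 -dimv_eq0 d1.
by apply/esym/eqP; rewrite eqEdim -memvE memv_pick d1 dim_vline nz.
Qed.

Let V_neq0 i : V i != 0.
Proof.
have d1 : \dim (phi i) = 1%N by apply/phi_onto; exists i.
by rewrite vpick0 -dimv_eq0 d1.
Qed.

Lemma proj_vector_onto v : v != 0 -> exists i, exists2 c, c != 0 & v = c *: V i.
Proof.
move=> nz; have /phi_onto[i e] : \dim <[v]>%VS = 1%N by rewrite dim_vline nz.
have /vlineP[c ev] : v \in <[V i]>%VS by rewrite -phiE e memv_line.
by exists i, c => //; apply: contraNneq nz => c0; rewrite ev c0 scale0r.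
Qed.

Lemma proj_vector_free i j a b :
  i != j -> a *: V i + b *: V j = 0 -> a = 0 /\ b = 0.
Proof.
move=> ij e; have a0 : a = 0.
  apply/eqP; apply: contraNT ij => na; apply/eqP/phi_inj/eqP.
  have -> : (phi i == phi j) = (phi i <= phi j)%VS.
    by rewrite eqEdim !phiE !dim_vline !V_neq0 leqnn andbT.
  rewrite !phiE -memvE; apply/vlineP; exists (- (a^-1 * b)).
  move/eqP: e; rewrite addr_eq0 => /eqP e.
  by rewrite -[LHS](scalerK na) e scalerN scalerA scaleNr.
split=> //; move/eqP: e; rewrite a0 scale0r add0r scaler_eq0.
by rewrite (negbTE (V_neq0 j)) orbF => /eqP.
Qed.

Let span2 i j k : i != j -> span_coll V i j k = (phi k <= phi i + phi j)%VS.
Proof.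
move=> ij; rewrite /span_coll (negbTE ij) /= !phiE -memvE.
apply/existsP/memv_addP => [[a /existsP[b /eqP e]]|].
  exists (a *: V i); first by rewrite memvZ // memv_line.
  by exists (b *: V j); first by rewrite memvZ // memv_line.
case=> u /vlineP[a ->] [v /vlineP[b ->] e].
by exists a; apply/existsP; exists b; rewrite e.
Qed.

Let dim2 i j : i != j -> \dim (phi i + phi j) = 2%N.
Proof.
move=> ij; rewrite dimv_disjoint_sum; first by rewrite !phiE !dim_vline !V_neq0.
apply/eqP; rewrite -subv0; apply/subvP=> v /memv_capP[].
rewrite !phiE => /vlineP[a ->] /vlineP[b] /eqP.
rewrite -subr_eq0 -scaleNr => /eqP/(proj_vector_free ij)[-> _].
by rewrite scale0r mem0v.
Qed.

Lemma proj_lines : coll_lines B (span_coll V).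
Proof.
move=> b; split=> [/phiB[W [dW ->]]|[i [j [ij ->]]]]; last first.
  apply/phiB; exists (phi i + phi j)%VS; rewrite dim2 //; split=> //.
  by apply/setP=> k; rewrite !inE span2.
have uW := memv_pick W; set u := vpick W in uW.
have nu : u != 0 by rewrite vpick0 -dimv_eq0 dW.
have /subvPn[v vW nv] : ~~ (W <= <[u]>)%VS.
  by apply/negP=> /dimvS; rewrite dW dim_vline nu.
have nv0 : v != 0 by apply: contraNneq nv => ->; rewrite mem0v.
have [i ei] : exists i, phi i = <[u]>%VS by apply/phi_onto; rewrite dim_vline nu.
have [j ej] : exists i, phi i = <[v]>%VS by apply/phi_onto; rewrite dim_vline nv0.
have ij : i != j.
  by apply: contraNneq nv => e; rewrite -ei e ej memv_line.
exists i, j; split=> //; apply/setP=> k; rewrite !inE span2 //.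
suff -> : W = (phi i + phi j)%VS by [].
apply/esym/eqP; rewrite eqEdim dim2 // dW leqnn andbT subv_add ei ej -!memvE.
by rewrite uW.
Qed.

Lemma proj_triangle : exists i j k, ~~ span_coll V i j k.
Proof.
have outside (W : {vspace 'rV[F]_3}) : (\dim W < 3)%N ->
    exists i, ~~ (phi i <= W)%VS.
  move=> dW; have /subvPn[v _ nv] : ~~ (fullv <= W)%VS.
    by apply/negP=> /dimvS; rewrite leqNgt dimvf /dim /= mul1n dW.
  have nv0 : v != 0 by apply: contraNneq nv => ->; rewrite mem0v.
  have [i ei] : exists i, phi i = <[v]>%VS by apply/phi_onto; rewrite dim_vline nv0.
  by exists i; rewrite ei -memvE.
have [i _] : exists i, ~~ (phi i <= 0%VS)%VS by apply: outside; rewrite dimv0.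
have [j nj] : exists j, ~~ (phi j <= phi i)%VS.
  by apply: outside; rewrite phiE dim_vline; case: (_ != _).
have ij : i != j by apply: contraNneq nj => ->.
have [k nk] : exists k, ~~ (phi k <= phi i + phi j)%VS.
  by apply: outside; rewrite dim2.
by exists i, j, k; rewrite span2.
Qed.

End Projective.

(** * Affine planes through lifted points *)

Section Affine.
Variables (F : finFieldType) (d : nat) (B : {set {set 'I_d}}).
Variable phi : 'I_d -> 'rV[F]_2.
Hypothesis phi_bij : bijective phi.
Hypothesis phiB : forall b : {set 'I_d}, b \in B <->
  exists (x : 'rV[F]_2) (U : {vspace 'rV[F]_2}),
    \dim U = 1%N /\ b = [set i | (phi i - x)%R \in U].

(** The affine plane is placed at height 1 in a space of dimension 3, where affine combinations of
    points become linear combinations of vectors. *)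
Definition aff_vector i : (F^o * 'rV[F]_2)%type := (1, phi i).
Let V := aff_vector.

Let phi_inj := bij_inj phi_bij.

Let phi_onto x : exists i, phi i = x.
Proof. by case: phi_bij => g _ gK; exists (g x); rewrite gK. Qed.

Lemma aff_vector_onto v : v.1 = 1 -> exists i, exists2 c, c != 0 & v = c *: V i.
Proof.
case: v => a x /= ->; have [i <-] := phi_onto x.
by exists i, 1; rewrite ?oner_eq0 ?scale1r.
Qed.

Lemma aff_vector_free i j a b :
  i != j -> a *: V i + b *: V j = 0 -> a = 0 /\ b = 0.
Proof.
move=> ij; rewrite /V /aff_vector => -[]; rewrite /= ![_ *: 1]mulr1 => /eqP.
rewrite addr_eq0 => /eqP->; rewrite scaleNr addrC -scalerBr => /eqP.
rewrite scaler_eq0 subr_eq0 (inj_eq phi_inj) (eq_sym j i) (negbTE ij) orbF => /eqP->.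
by rewrite oppr0.
Qed.

Let span2 i j k : i != j ->
  span_coll V i j k = (phi k - phi i \in <[phi j - phi i]>%VS).
Proof.
move=> ij; rewrite /span_coll (negbTE ij) /=; apply/existsP/vlineP.
  case=> a /existsP[b /eqP[]]; rewrite /= ![_ *: 1]mulr1 => e1 ->.
  (* The heights force a + b = 1, so the linear combination is an affine one. *)
  exists b; rewrite (_ : a = 1 - b); last by rewrite e1 addrK.
  by rewrite scalerBl scale1r scalerBr addrAC (addrAC (phi i)) subrr add0r addrC.
case=> c e; exists (1 - c); apply/existsP; exists c; apply/eqP.
congr (_, _); first by rewrite /= ![_ *: 1]mulr1 subrK.
move/eqP: e; rewrite subr_eq => /eqP->.
by rewrite scalerBl scale1r scalerBr addrAC [c *: phi j + _]addrC [RHS]addrAC.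
Qed.

Lemma aff_lines : coll_lines B (span_coll V).
Proof.
move=> b; split=> [/phiB[x [U [dU ->]]]|[i [j [ij ->]]]]; last first.
  apply/phiB; exists (phi i), <[phi j - phi i]>%VS; split.
    by rewrite dim_vline subr_eq0 (inj_eq phi_inj) eq_sym ij.
  by apply/setP=> k; rewrite !inE span2.
have nu : vpick U != 0 by rewrite vpick0 -dimv_eq0 dU.
have eU : U = <[vpick U]>%VS.
  by apply/esym/eqP; rewrite eqEdim -memvE memv_pick dU dim_vline nu.
have [i ei] := phi_onto x; have [j ej] := phi_onto (vpick U + x).
have ij : i != j.
  by rewrite -(inj_eq phi_inj) ei ej -subr_eq0 opprD addrCA subrr addr0 oppr_eq0.
exists i, j; split=> //; apply/setP=> k; rewrite !inE span2 // ei ej addrK.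
by rewrite -eU.
Qed.

Lemma aff_triangle : exists i j k, ~~ span_coll V i j k.
Proof.
have outside (W : {vspace 'rV[F]_2}) : (\dim W < 2)%N -> exists v, v \notin W.
  move=> dW; have /subvPn[v _ nv] : ~~ (fullv <= W)%VS.
    by apply/negP=> /dimvS; rewrite leqNgt dimvf /dim /= mul1n dW.
  by exists v.
have [u nu] : exists u : 'rV[F]_2, u \notin 0%VS by apply: outside; rewrite dimv0.
have [v nv] : exists v, v \notin <[u]>%VS.
  by apply: outside; rewrite dim_vline; case: (_ != _).
have [i ei] := phi_onto 0; have [j ej] := phi_onto u; have [k ek] := phi_onto v.
exists i, j, k; rewrite span2 ?ei ?ej ?ek ?subr0 //.
by rewrite -(inj_eq phi_inj) ei ej eq_sym -memv0.
Qed.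

End Affine.

(** A nonzero triple of coordinates gives a nonzero vector, since the three vectors of a triangle
    are linearly independent; that vector spans a point of the plane. *)
Lemma PG_plane (F : finFieldType) q add mul (el : nat -> F) pts d
    (B : {set {set 'I_d}}) (phi : 'I_d -> {vspace 'rV[F]_3}) :
    field_code q add mul el -> model_check q add mul pts -> size pts = d ->
    all (fun m => m != (0, 0, 0)%N) pts ->
    injective phi ->
    (forall U : {vspace 'rV[F]_3}, \dim U = 1%N <-> exists i, phi i = U) ->
    (forall b : {set 'I_d}, b \in B <->
       exists W : {vspace 'rV[F]_3},
         \dim W = 2 /\ b = [set i | (phi i <= W)%VS]) ->
  exists coll, [/\ plane_space coll, rainbow_rigid coll & coll_lines B coll].
Proof.
move=> hel chk sz /allP nz phi_inj phi_onto phiB.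
have Vfree := proj_vector_free phi_inj phi_onto.
exists (span_coll (proj_vector phi)).
have [||hP hR] := span_coll_plane hel chk sz Vfree.
- exact: proj_triangle.
- move=> i j k m nc pm; apply: proj_vector_onto => //.
  apply: contraNneq (nz m pm) => /(triangle_free Vfree nc)[].
  have q0 := ltnW (code_gt1 hel); rewrite -(code0 hel).
  have /andP[/and3P[/allP/(_ m pm) + _ _] _] := chk.
  case: m {pm} => [[a b] c] /= /and3P[ha hb hc].
  by move=> /(code_inj hel ha q0)-> /(code_inj hel hb q0)-> /(code_inj hel hc q0)->.
by split=> //; apply: proj_lines.
Qed.

(** Barycentric coordinates sum to 1, so the vector they give has height 1 and is the lift of a
    point. *)
Lemma AG_plane (F : finFieldType) q add mul (el : nat -> F) pts d
    (B : {set {set 'I_d}}) (phi : 'I_d -> 'rV[F]_2) :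
    field_code q add mul el -> model_check q add mul pts -> size pts = d ->
    all (fun m => add (add m.1.1 m.1.2) m.2 == 1%N) pts ->
    bijective phi ->
    (forall b : {set 'I_d}, b \in B <->
       exists (x : 'rV[F]_2) (U : {vspace 'rV[F]_2}),
         \dim U = 1%N /\ b = [set i | (phi i - x)%R \in U]) ->
  exists coll, [/\ plane_space coll, rainbow_rigid coll & coll_lines B coll].
Proof.
move=> hel chk sz /allP sum1 phi_bij phiB.
have Vfree := aff_vector_free phi_bij.
exists (span_coll (aff_vector phi)).
have [||hP hR] := span_coll_plane hel chk sz Vfree.
- exact: aff_triangle.
- move=> i j k m _ pm; apply: aff_vector_onto => //=; rewrite ![_ *: 1]mulr1.
  have /andP[/and3P[/allP/(_ m pm)/and3P[ha hb hc] _ _] _] := chk.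
  have [l e] := code_add hel ha hb; have [_ e'] := code_add hel l hc.
  by rewrite -e -e' (eqP (sum1 m pm)) (code1 hel).
by split=> //; apply: aff_lines.
Qed.

Local Close Scope ring_scope.

Theorem theorem7p3 (d : nat) (B : {set {set 'I_d}}) (M : matroid 'I_d)
    (hB : [\/ d = 7 /\ is_PG2 2 B, d = 13 /\ is_PG2 3 B,
              d = 9 /\ is_AG2 3 B | d = 16 /\ is_AG2 4 B])
    (hM : is_plane_matroid B M) :
  [/\ forall b, b \in B -> exists! N, is_line_degeneration b N,
      forall i, exists! N, is_coloop_degeneration B i N,
      forall i, exists! N, is_loop_degeneration M i N
    & forall N : matroid 'I_d,
        maximal_below M N <->
        [\/ exists2 b, b \in B & is_line_degeneration b N,
            exists i, is_coloop_degeneration B i N,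
            exists i, is_loop_degeneration M i N
          | N = uniform 'I_d 2]].
Proof.
suff [coll [hP hR hl]] : exists coll,
    [/\ plane_space coll, rainbow_rigid coll & coll_lines B coll].
  exact: plane_maximal_below hP hR hl hM.
case: hB => -[ed [F [phi]]].
- case=> cF phi_inj phi_onto phiB; have hel := prime_field_code (isT : prime 2) cF.
  by apply: (PG_plane hel PG2_check) phi_inj phi_onto phiB; rewrite ?ed.
- case=> cF phi_inj phi_onto phiB; have hel := prime_field_code (isT : prime 3) cF.
  by apply: (PG_plane hel PG3_check) phi_inj phi_onto phiB; rewrite ?ed.
- case=> cF phi_bij phiB; have hel := prime_field_code (isT : prime 3) cF.
  by apply: (AG_plane hel AG3_check) phi_bij phiB; rewrite ?ed.
- case=> cF phi_bij phiB; have [el hel] := field4_code cF.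
  by apply: (AG_plane hel AG4_check) phi_bij phiB; rewrite ?ed.
Qed.
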